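(* Let $A_\Gamma^+$ be an arbitrary Artin monoid (with $\Gamma$ any finite labelled graph as in the context). Then the monoid Deligne complex $\mathcal{D}_\Gamma^+$ is contractible.
   Context: Let $\Gamma$ be a finite simple graph with vertex set $S$ and edge set $E$, each edge $(s,t)$ labelled by an integer $m_{st}\ge 2$. The Artin group $A_\Gamma$ has presentation $\langle S \mid sts\cdots = tst\cdots \ (\text{both sides of length } m_{st}) \ \forall (s,t)\in E\rangle$, and the Artin monoid $A_\Gamma^+$ is the monoid with the same (positive) presentation. For $T\subseteq S$, $A_T$ is the subgroup generated by $T$ and $A_T^+$ the submonoid generated by $T$. The Coxeter group $W_T$ is obtained from the presentation of $A_T$ by adding $s^2=e$ for $s\in T$; $\mathcal S^f=\{T\subseteq S: W_T \text{ is finite}\}$ (i.e. $A_T$ is of finite type). Monoid cosets: for $T\subseteq S$ and $\alpha,\beta\in A_\Gamma^+$ write $\alpha\sim_T\beta$ if $\alpha t=\beta t'$ for some $t,t'\in A_T^+$; let $\approx_T$ be the transitive closure of $\sim_T$, and let $[\alpha]_T$ denote the $\approx_T$-equivalence class of $\alpha$. The monoid Deligne complex $\mathcal{D}_\Gamma^+$ is the cube complex whose vertices are the classes $[\alpha]_T$ with $\alpha\in A_\Gamma^+$, $T\in\mathcal S^f$, partially ordered by inclusion, where for $T_1\subseteq T_2$ (both in $\mathcal S^f$) the interval $[[\alpha]_{T_1},[\alpha]_{T_2}]$ (consisting of the $[\alpha]_T$ with $T_1\subseteq T\subseteq T_2$) spans a cube of dimension $|T_2\setminus T_1|$. *)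

(* Defs.v *)
From mathcomp Require Import all_boot.
From Stdlib Require Import Reals Relations.

Set Implicit Arguments.
Unset Strict Implicit.
Unset Printing Implicit Defensive.

Section ArtinDeligne.
Variables (S : finType) (E : rel S) (m : S -> S -> nat).

Fixpoint alt (s t : S) (k : nat) : seq S :=
  if k is k'.+1 then s :: alt t s k' else [::].

Inductive artin_step : seq S -> seq S -> Prop :=
| ArtinStep (u v : seq S) (s t : S) :
    E s t -> artin_step (u ++ alt s t (m s t) ++ v) (u ++ alt t s (m s t) ++ v).

Definition artin_eq : relation (seq S) := clos_refl_sym_trans _ artin_step.

Definition word_over (T : {set S}) (w : seq S) : bool := all (fun x => x \in T) w.

Definition sim_T (T : {set S}) (a b : seq S) : Prop :=
  exists t t', word_over T t /\ word_over T t' /\ artin_eq (a ++ t) (b ++ t').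

Definition approx_T (T : {set S}) : relation (seq S) := clos_trans _ (sim_T T).

(** Coxeter group W_T : generators T, relations s^2 = e (s in T) and the
    braid relations for edges (s,t) with s,t in T.  Since the generators are
    involutions, W_T is the monoid on T with these relations. *)
Inductive cox_step (T : {set S}) : seq S -> seq S -> Prop :=
| CoxSq (u v : seq S) (s : S) :
    word_over T u -> word_over T v -> s \in T ->
    cox_step T (u ++ [:: s; s] ++ v) (u ++ v)
| CoxBraid (u v : seq S) (s t : S) :
    word_over T u -> word_over T v -> s \in T -> t \in T -> E s t ->
    cox_step T (u ++ alt s t (m s t) ++ v) (u ++ alt t s (m s t) ++ v).

Definition cox_eq (T : {set S}) : relation (seq S) :=
  clos_refl_sym_trans _ (cox_step T).

Definition coxeter_finite (T : {set S}) : Prop :=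
  exists l : seq (seq S), forall w, word_over T w ->
    exists2 w', w' \in l & cox_eq T w w'.

(** Vertices of D_Gamma^+ : the subsets [alpha]_T of A_Gamma^+ (represented
    as predicates on words, closed under artin_eq), T in S^f. *)
Definition is_vertex (P : seq S -> Prop) : Prop :=
  exists (a : seq S) (T : {set S}),
    coxeter_finite T /\ forall w, P w <-> approx_T T a w.

Definition vertex := {P : seq S -> Prop | is_vertex P}.

Definition vle (v w : vertex) : Prop := forall x, proj1_sig v x -> proj1_sig w x.

Local Open Scope R_scope.

Definition is_chain (c : list vertex) : Prop :=
  forall v w, List.In v c -> List.In w c -> vle v w \/ vle w v.

Definition supp_in (f : vertex -> R) (c : list vertex) : Prop :=
  forall v, f v <> 0 -> List.In v c.

Definition rsum (c : list vertex) (f : vertex -> R) : R :=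
  List.fold_right (fun v acc => f v + acc) 0 c.

(** Points of |D_Gamma^+| : finitely supported barycentric coordinates,
    nonnegative, summing to 1, supported on a chain. *)
Definition is_point (f : vertex -> R) : Prop :=
  (forall v, 0 <= f v) /\
  exists c, List.NoDup c /\ is_chain c /\ supp_in f c /\ rsum c f = 1.

Definition in_simplex (c : list vertex) (f : vertex -> R) : Prop :=
  is_point f /\ supp_in f c.

Definition sdist (c : list vertex) (f g : vertex -> R) : R :=
  rsum c (fun v => Rabs (f v - g v)).

(** Weak (CW) topology: U is open iff its trace on every closed simplex is
    open for the Euclidean topology of that simplex. *)
Definition weak_open (U : (vertex -> R) -> Prop) : Prop :=
  forall c, is_chain c -> forall f, in_simplex c f -> U f ->
    exists eps, 0 < eps /\
      forall g, in_simplex c g -> sdist c f g < eps -> U g.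

Definition prod_open (W : (vertex -> R) -> R -> Prop) : Prop :=
  forall x t, is_point x -> 0 <= t <= 1 -> W x t ->
    exists U delta, weak_open U /\ U x /\ 0 < delta /\
      forall y s, is_point y -> U y -> 0 <= s <= 1 -> Rabs (s - t) < delta ->
        W y s.

Definition contractible_realization : Prop :=
  exists (x0 : vertex -> R) (H : (vertex -> R) -> R -> (vertex -> R)),
    is_point x0 /\
    (forall x t, is_point x -> 0 <= t <= 1 -> is_point (H x t)) /\
    (forall U, weak_open U -> prod_open (fun x t => U (H x t))) /\
    (forall x, is_point x -> H x 0 = x /\ H x 1 = x0).

End ArtinDeligne.

(* Main.v *)
From Stdlib Require Import Reals Relations Lra List Permutation.
From Stdlib Require Import Classical ClassicalEpsilon FunctionalExtensionality PropExtensionality.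
From mathcomp Require Import all_boot.
Require Import Defs.

(**
The T-reduced representatives (no right divisor in T) identify the vertices
of the complex with pairs (a, T); let the level of (a, T) be the length of a.
Let D_n be the subcomplex spanned by the vertices of level at most n.  The
simplices of D_n with a vertex of level n all lie above some [a]_{} with a of
length n, and if R is the set of right descents of a, then the vertices of
lower level above [a]_{} are the [a]_T with T meeting R.  As W_R is finite,
these contract through [a]_T >= [a]_{T cap R} <= [a]_R, so D_n deformation
retracts onto D_{n-1}; infinitely many such retractions are performed on the
intervals [2^-(n+1), 2^-n].

The facts needed on Artin monoids (cancellation, the reduction lemma
X s = Y t, finiteness of W_R) are obtained from the numbers game: a word is
reduced when it fires only positive values, reduced words satisfy the exchange
condition, and reduced divisors of a common element have a reduced join.
*)

Set Implicit Arguments.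
Unset Strict Implicit.
Unset Printing Implicit Defensive.

(** * The topology of the realization *)

(** The obstacle to retracting D_n onto D_(n-1) is continuity where the mass at level n tends to 0,
    since points of D_(n-1) must stay fixed. The poset maps can therefore not be applied to all the
    lower mass: only as much mass below level n is trimmed as there is mass at level n. To stay on
    chains at every time, this mass is taken from the bottom, so that the trimmed vertices lie below
    all others that keep mass, apart from [a]_{} itself. The vertex [a]_R receives mass only when
    there is less mass below level n than at level n, and then all of it has been trimmed and lies
    below [a]_R. *)

Section Realization.
Variables (S : finType) (E : rel S) (m : S -> S -> nat).
Local Notation V := (vertex E m).
Local Notation vdec v w := (excluded_middle_informative (v = w :> V)).
Lemma vle_refl (v : V) : vle v v.
Proof. by []. Qed.

Lemma vle_trans (u v w : V) : vle u v -> vle v w -> vle u w.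
Proof. by move=> uv vw x /uv/vw. Qed.

Lemma vertex_ext (v w : V) : (forall x, proj1_sig v x <-> proj1_sig w x) -> v = w.
Proof.
case: v w => [P hP] [Q hQ] /= H.
have PQ : P = Q by apply: functional_extensionality => x; exact: propositional_extensionality.
by subst Q; congr exist; exact: proof_irrelevance.
Qed.

Lemma vle_antisym (v w : V) : vle v w -> vle w v -> v = w.
Proof. by move=> vw wv; apply: vertex_ext => x; split; [exact: vw|exact: wv]. Qed.

Local Open Scope R_scope.

Lemma Rmin_cases a b : (a <= b /\ Rmin a b = a) \/ (b <= a /\ Rmin a b = b).
Proof. by rewrite /Rmin; case: Rle_dec; lra. Qed.

Lemma Rmax_cases a b : (a <= b /\ Rmax a b = b) \/ (b <= a /\ Rmax a b = a).
Proof. by rewrite /Rmax; case: Rle_dec; lra. Qed.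

(** * Finite sums over lists of vertices *)

Lemma rsum_cons v (c : list V) (f : V -> R) : rsum (v :: c) f = f v + rsum c f.
Proof. by []. Qed.

Lemma rsum_ext (c : list V) (f g : V -> R) :
  (forall v, In v c -> f v = g v) -> rsum c f = rsum c g.
Proof.
elim: c => // v c IH H; rewrite !rsum_cons H ?IH //; last by left.
by move=> w wc; apply: H; right.
Qed.

Lemma rsum_plus (c : list V) (f g : V -> R) :
  rsum c (fun v => f v + g v) = rsum c f + rsum c g.
Proof. elim: c => [|v c IH]; rewrite ?rsum_cons ?IH /=; lra. Qed.

Lemma rsum_scal (c : list V) k (f : V -> R) : rsum c (fun v => k * f v) = k * rsum c f.
Proof. elim: c => [|v c IH]; rewrite ?rsum_cons ?IH /=; lra. Qed.

Lemma rsum0 (c : list V) : rsum c (fun=> 0) = 0.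
Proof. elim: c => [|v c IH]; rewrite ?rsum_cons ?IH /=; lra. Qed.

Lemma rsum_le (c : list V) (f g : V -> R) :
  (forall v, In v c -> f v <= g v) -> rsum c f <= rsum c g.
Proof.
elim: c => [|v c IH] H; first by rewrite /=; lra.
rewrite !rsum_cons.
have := H v (or_introl erefl); have : rsum c f <= rsum c g; last by lra.
by apply: IH => w wc; apply: H; right.
Qed.

Lemma rsum_ge0 (c : list V) (f : V -> R) : (forall v, In v c -> 0 <= f v) -> 0 <= rsum c f.
Proof. by move=> H; rewrite -(rsum0 c); apply: rsum_le. Qed.

Lemma rsum_eq0 (c : list V) (f : V -> R) : (forall v, In v c -> 0 <= f v) ->
  rsum c f = 0 -> forall v, In v c -> f v = 0.
Proof.
elim: c => [|w c IH] //; rewrite rsum_cons => H e.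
have h0 : 0 <= rsum c f by apply: rsum_ge0 => v vc; apply: H; right.
have h1 := H w (or_introl erefl).
have h2 : rsum c f = 0 by lra.
move=> v [<-|vc]; first by lra.
by apply: IH => // u uc; apply: H; right.
Qed.

Lemma rsum_perm (c d : list V) f : Permutation c d -> rsum c f = rsum d f.
Proof.
elim=> [|v c' d' _ IH|v w c'|c1 c2 c3 _ -> _ ->] //; rewrite !rsum_cons ?IH //; lra.
Qed.

Lemma rsum_swap (c d : list V) (f : V -> V -> R) :
  rsum c (fun u => rsum d (f u)) = rsum d (fun v => rsum c (f^~ v)).
Proof.
elim: c => [|u c IH]; first by rewrite /= rsum0.
by rewrite rsum_cons IH -rsum_plus.
Qed.

Definition nonzero (f : V -> R) v : bool :=
  if excluded_middle_informative (f v <> 0) then true else false.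

Lemma nonzeroP f v : nonzero f v = true <-> f v <> 0.
Proof. by rewrite /nonzero; case: excluded_middle_informative. Qed.

Lemma rsum_filter (c : list V) f : rsum c f = rsum (List.filter (nonzero f) c) f.
Proof.
elim: c => // v c IH; rewrite rsum_cons IH /=.
case e: (nonzero f v) => //=.
have -> : f v = 0 by apply: NNPP => /nonzeroP; rewrite e.
lra.
Qed.

(** Both sums run over the support of [f]; this is why the carrier chosen for a point does not
    matter. *)
Lemma rsum_indep (c d : list V) f : NoDup c -> NoDup d -> supp_in f c -> supp_in f d ->
  rsum c f = rsum d f.
Proof.
move=> uc ud fc fd; rewrite (rsum_filter c) (rsum_filter d); apply: rsum_perm.
apply: NoDup_Permutation; try exact: NoDup_filter.
move=> v; rewrite !filter_In nonzeroP; split=> -[_ h]; split=> //; [exact: fd|exact: fc].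
Qed.

Definition delta (d u : V) : R := if vdec d u then 1 else 0.

Lemma delta_ge0 d u : 0 <= delta d u.
Proof. rewrite /delta; case: excluded_middle_informative => ? /=; lra. Qed.

Lemma delta_neq0 d u : delta d u <> 0 -> d = u.
Proof. by rewrite /delta; case: excluded_middle_informative. Qed.

Lemma deltavv d : delta d d = 1.
Proof. by rewrite /delta; case: excluded_middle_informative. Qed.

Lemma rsum_delta (c : list V) d (f : V -> R) : NoDup c -> In d c ->
  rsum c (fun u => f u * delta d u) = f d.
Proof.
move=> uc dc.
rewrite (@rsum_indep c [:: d]) //=.
- by rewrite deltavv; lra.
- by constructor=> //; constructor.
- by move=> v; case: (vdec d v) => [<- //|dv]; rewrite /delta; case: excluded_middle_informative => //= _; lra.
- by move=> v; case: (vdec d v) => [<- //|dv]; [left|rewrite /delta; case: excluded_middle_informative => //= _; lra].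
Qed.

Lemma rsum_push (L c : list V) (d : V -> V) (f : V -> R) : NoDup L ->
  (forall v, In v c -> In (d v) L) ->
  rsum L (fun u => rsum c (fun v => f v * delta (d v) u)) = rsum c f.
Proof.
move=> uL dL; rewrite rsum_swap; apply: rsum_ext => v vc.
by rewrite (@rsum_delta L (d v) (fun=> f v)) //; exact: dL.
Qed.

Lemma rsum_neq0 (c : list V) f : rsum c f <> 0 -> exists2 v, In v c & f v <> 0.
Proof.
elim: c => [|w c IH] //; rewrite rsum_cons => h; case: (classic (f w = 0)) => fw.
  have [|v vc fv] := IH; last by exists v => //; right.
  by lra.
by exists w => //; left.
Qed.

Lemma rsum_fdelta (c : list V) f u : NoDup c -> supp_in f c ->
  rsum c (fun v => f v * delta v u) = f u.
Proof.
move=> uc fc; case: (classic (f u = 0)) => fu.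
  rewrite fu -(rsum0 c); apply: rsum_ext => v _; case: (vdec v u) => [->|vu].
    by rewrite fu; lra.
  by rewrite /delta; case: excluded_middle_informative => //= _; lra.
rewrite -(@rsum_delta c u f uc (fc _ fu)); apply: rsum_ext => v _.
by rewrite /delta; do 2![case: excluded_middle_informative => //=]; move=> *; subst.
Qed.

(** * Filling a chain from the bottom *)

Definition vlt (u w : V) := vle u w /\ u <> w.

Section Filling.
Variable x : V -> R.
Hypothesis x_ge0 : forall v, 0 <= x v.
Variable K : R.
Hypothesis K_ge0 : 0 <= K.

(* Fill a chain with [K] units of mass from the bottom, [x w] being the capacity of [w]. *)
Definition below (c : list V) w :=
  rsum c (fun u => if excluded_middle_informative (vlt u w) then x u else 0).

Definition filled (c : list V) w := Rmax 0 (Rmin (x w) (K - below c w)).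

Lemma filled_ge0 c w : 0 <= filled c w.
Proof. exact: Rmax_l. Qed.

Lemma filled_le c w : filled c w <= x w.
Proof. apply: Rmax_lub => //; exact: Rmin_l. Qed.

Lemma chain_max (c : list V) : is_chain c -> c <> [::] -> exists2 z, In z c & forall v, In v c -> vle v z.
Proof.
elim: c => // v c IH ch _; case: (classic (c = [::])) => [->|cn].
  by exists v; [left|move=> w [<-|[]]].
have [|//|z zc zmax] := IH; first by move=> a b ac bc; apply: ch; right.
case: (ch v z); try by [left|right].
- by move=> vz; exists z; [right|move=> w [<-|/zmax]].
- by move=> zv; exists v; [left|move=> w [<-|/zmax wz] // y /wz /zv].
Qed.

Lemma vlt_irr v : ~ vlt v v. Proof. by case. Qed.

(** By removal of the greatest vertex [z]: no other vertex sees it in [below], and [z] is offered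
    what the rest of the chain cannot hold. *)
Lemma rsum_filled c : NoDup c -> is_chain c -> rsum c (filled c) = Rmin K (rsum c x).
Proof.
elim: {c}(length c) {-2}c (erefl (length c)) => [|n IH] c sz uc ch.
  by case: c sz {uc ch} => //= _; rewrite Rmin_right.
have cn : c <> [::] by case: c sz {uc ch}.
have [z zc zmax] := chain_max ch cn.
have [c1 [c2 cE]] := in_split _ _ zc.
have perm : Permutation c (z :: (c1 ++ c2)).
  by rewrite cE; apply: Permutation_sym; exact: Permutation_middle.
set c' := c1 ++ c2 in perm.
have /NoDup_cons_iff [zc' uc'] : NoDup (z :: c') by exact: Permutation_NoDup perm uc.
have inc v : In v c' -> In v c.
  by move=> vc; apply: Permutation_in (Permutation_sym perm) _; right.
have ch' : is_chain c' by move=> a b ac bc; apply: ch; exact: inc.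
have sz' : length c' = n by have := Permutation_length perm; rewrite sz /= => -[].
have bE v : In v c -> below c v = below c' v.
  move=> vc; rewrite /below (rsum_perm _ perm) rsum_cons.
  case: excluded_middle_informative => [[zv nzv]|?] /=; last by lra.
  by case: nzv; apply: vle_antisym => //; exact: zmax.
have bz : below c' z = rsum c' x.
  apply: rsum_ext => v vc; case: excluded_middle_informative => //= nv; case: nv; split.
    exact/zmax/inc.
  by move=> vz; apply: zc'; rewrite -vz.
rewrite (rsum_perm _ perm) (rsum_perm x perm) !rsum_cons.
have -> : rsum c' (filled c) = rsum c' (filled c').
  by apply: rsum_ext => v /inc vc; rewrite /filled bE.
rewrite IH // {1}/filled bE // bz.
have := x_ge0 z; have : 0 <= rsum c' x by apply: rsum_ge0.
have := Rmin_cases K (rsum c' x); have := Rmin_cases K (x z + rsum c' x).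
have := Rmin_cases (x z) (K - rsum c' x).
by have := Rmax_cases 0 (Rmin (x z) (K - rsum c' x)); lra.
Qed.

(** If [w] receives anything, the mass strictly below [w], which includes [x v] and everything below
    [v], does not exhaust [K]. *)
Lemma filled_full c v w : NoDup c -> In v c -> vlt v w -> filled c w <> 0 -> filled c v = x v.
Proof.
move=> uc vc vw fw.
have h1 : below c v + x v <= below c w.
  rewrite -(@rsum_delta c v x uc vc) -rsum_plus; apply: rsum_le => u _.
  have := x_ge0 u; rewrite /delta.
  case: (vdec v u) => vu /=; [subst u|]; case: excluded_middle_informative => h1;
    case: excluded_middle_informative => h2 /=; try by lra.
  - by case: (vlt_irr h1).
  - by case: (vlt_irr h1).
  - by case: h2.
  - case: h2; split; first by move=> y; case: vw => vw _ /(proj1 h1) /vw.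
    move=> uw; subst w; case: h1 => uv _; case: vw => vu' ne.
    by apply: ne; apply: vle_antisym.
have h2 : below c w < K.
  apply: Rnot_le_lt => h; apply: fw; rewrite /filled; have := x_ge0 w.
  have := Rmin_cases (x w) (K - below c w).
  by have := Rmax_cases 0 (Rmin (x w) (K - below c w)); lra.
rewrite /filled; have := x_ge0 v; have := Rmin_cases (x v) (K - below c v).
by have := Rmax_cases 0 (Rmin (x v) (K - below c v)); lra.
Qed.
End Filling.

(** * Continuity on the prism over a simplex *)

Section Near.
Variables (c : list V) (f : V -> R) (t : R).

(** The neighbourhood filter of (f, t) in the prism over [c]; its closure under finite intersections
    carries the continuity arguments. *)
Definition near (P : (V -> R) -> R -> Prop) := exists eps, 0 < eps /\
  forall g s, in_simplex c g -> 0 <= s <= 1 -> sdist c f g < eps -> Rabs (s - t) < eps -> P g s.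

Lemma near_imp (P Q : (V -> R) -> R -> Prop) :
  (forall g s, in_simplex c g -> 0 <= s <= 1 -> P g s -> Q g s) -> near P -> near Q.
Proof. by move=> H [e [e0 h]]; exists e; split=> // g s gc sI d1 d2; apply: H => //; exact: h. Qed.

Lemma near_all (P : (V -> R) -> R -> Prop) :
  (forall g s, in_simplex c g -> 0 <= s <= 1 -> P g s) -> near P.
Proof. by move=> H; exists 1; split; [lra|move=> g s gc sI _ _; exact: H]. Qed.

Lemma near_and (P Q : (V -> R) -> R -> Prop) : near P -> near Q -> near (fun g s => P g s /\ Q g s).
Proof.
move=> [e [e0 h]] [e' [e'0 h']]; exists (Rmin e e'); split; first exact: Rmin_pos.
move=> g s gc sI d1 d2; have := Rmin_l e e'; have := Rmin_r e e' => ? ?.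
by split; [apply: h|apply: h'] => //; lra.
Qed.

Lemma near_list A (l : list A) (P : A -> (V -> R) -> R -> Prop) :
  (forall a, In a l -> near (P a)) -> near (fun g s => forall a, In a l -> P a g s).
Proof.
elim: l => [|a l IH] H; first by apply: near_all => g s _ _ b [].
apply: near_imp (near_and (H a (or_introl erefl)) (IH _)) => [g s _ _ [Pa Pl] b [<- //|]|b bl].
  exact: Pl.
by apply: H; right.
Qed.

Definition cont (p : (V -> R) -> R -> R) :=
  forall eps, 0 < eps -> near (fun g s => Rabs (p g s - p f t) < eps).

Lemma cont_const k : cont (fun _ _ => k).
Proof. by move=> e e0; apply: near_all => *; rewrite Rminus_diag Rabs_R0. Qed.

Lemma cont_plus p q : cont p -> cont q -> cont (fun g s => p g s + q g s).
Proof.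
move=> hp hq e e0; have e2 : 0 < e / 2 by lra.
apply: near_imp (near_and (hp _ e2) (hq _ e2)) => g s _ _ [h1 h2].
have -> : p g s + q g s - (p f t + q f t) = (p g s - p f t) + (q g s - q f t) by ring.
by have := Rabs_triang (p g s - p f t) (q g s - q f t); lra.
Qed.

Lemma cont_mult p q : cont p -> cont q -> cont (fun g s => p g s * q g s).
Proof.
move=> hp hq e e0; set A := Rabs (p f t) + 1; set B := Rabs (q f t) + 1.
have A0 : 1 <= A by have := Rabs_pos (p f t); rewrite /A; lra.
have B0 : 1 <= B by have := Rabs_pos (q f t); rewrite /B; lra.
(* The cap 1 keeps the absolute value of [p g s] below [A]. *)
have e1 : 0 < Rmin 1 (e / (2 * B)) by apply: Rmin_pos; [lra|apply: Rdiv_lt_0_compat; lra].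
have e2 : 0 < e / (2 * A) by apply: Rdiv_lt_0_compat; lra.
apply: near_imp (near_and (hp _ e1) (hq _ e2)) => g s _ _ [].
have := Rmin_l 1 (e / (2 * B)); have := Rmin_r 1 (e / (2 * B)).
move: (Rmin _ _) => r r1 r2 h1 h2.
have -> : p g s * q g s - p f t * q f t =
  p g s * (q g s - q f t) + (p g s - p f t) * q f t by ring.
apply: Rle_lt_trans (Rabs_triang _ _) _; rewrite !Rabs_mult.
have hA : Rabs (p g s) <= A.
  have -> : p g s = p f t + (p g s - p f t) by ring.
  by have := Rabs_triang (p f t) (p g s - p f t); rewrite /A; lra.
have b1 : Rabs (p g s) * Rabs (q g s - q f t) < e / 2.
  apply: (@Rle_lt_trans _ (A * Rabs (q g s - q f t))).
    by apply: Rmult_le_compat_r => //; exact: Rabs_pos.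
  have -> : e / 2 = A * (e / (2 * A)) by field; lra.
  by apply: Rmult_lt_compat_l => //; lra.
have b2 : Rabs (p g s - p f t) * Rabs (q f t) <= e / 2.
  have -> : e / 2 = (e / (2 * B)) * B by field; lra.
  by apply: Rmult_le_compat; [exact: Rabs_pos|exact: Rabs_pos|lra|rewrite /B; lra].
by lra.
Qed.

(** Max, min, difference and distance are all 1-Lipschitz in this sense. *)
Lemma cont_lip2 (op : R -> R -> R) p q :
  (forall a b a' b', Rabs (op a b - op a' b') <= Rabs (a - a') + Rabs (b - b')) ->
  cont p -> cont q -> cont (fun g s => op (p g s) (q g s)).
Proof.
move=> lip hp hq e e0; have e2 : 0 < e / 2 by lra.
apply: near_imp (near_and (hp _ e2) (hq _ e2)) => g s _ _ [h1 h2].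
by have := lip (p g s) (q g s) (p f t) (q f t); lra.
Qed.

Lemma Rabs_cases a : (0 <= a /\ Rabs a = a) \/ (a <= 0 /\ Rabs a = - a).
Proof. by rewrite /Rabs; case: Rcase_abs; lra. Qed.

Lemma cont_max p q : cont p -> cont q -> cont (fun g s => Rmax (p g s) (q g s)).
Proof.
apply: cont_lip2 => a b a' b'; have := Rmax_cases a b; have := Rmax_cases a' b'.
have := Rabs_cases (a - a'); have := Rabs_cases (b - b').
by have := Rabs_cases (Rmax a b - Rmax a' b'); lra.
Qed.

Lemma cont_min p q : cont p -> cont q -> cont (fun g s => Rmin (p g s) (q g s)).
Proof.
apply: cont_lip2 => a b a' b'; have := Rmin_cases a b; have := Rmin_cases a' b'.
have := Rabs_cases (a - a'); have := Rabs_cases (b - b').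
by have := Rabs_cases (Rmin a b - Rmin a' b'); lra.
Qed.

Lemma cont_minus p q : cont p -> cont q -> cont (fun g s => p g s - q g s).
Proof.
apply: cont_lip2 => a b a' b'.
have := Rabs_cases (a - a'); have := Rabs_cases (b - b').
by have := Rabs_cases (a - b - (a' - b')); lra.
Qed.

Lemma cont_rsum (d : list V) (p : V -> (V -> R) -> R -> R) :
  (forall v, cont (p v)) -> cont (fun g s => rsum d (fun v => p v g s)).
Proof.
move=> H; elim: d => [|v d IH]; first exact: cont_const.
exact: (@cont_plus (p v) (fun g s => rsum d (fun v => p v g s))).
Qed.

Lemma cont_time : cont (fun _ s => s).
Proof. by move=> e e0; exists e; split. Qed.

Lemma cont_ext p q : in_simplex c f -> 0 <= t <= 1 ->
  (forall g s, in_simplex c g -> 0 <= s <= 1 -> p g s = q g s) -> cont p -> cont q.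
Proof.
move=> fc tI H hp e e0; apply: near_imp (hp e e0) => g s gc sI.
by rewrite !H.
Qed.

Lemma cont_coord v : in_simplex c f -> cont (fun g _ => g v).
Proof.
move=> [_ fc] e e0; exists e; split=> // g s [_ gc] sI d _.
case: (classic (In v c)) => vc; last first.
  have -> : f v = 0 by apply: NNPP => /fc.
  have -> : g v = 0 by apply: NNPP => /gc.
  by rewrite Rminus_diag Rabs_R0.
apply: Rle_lt_trans d; rewrite Rabs_minus_sym /sdist.
elim: c vc => //= w d IH [->|/IH h].
  have : 0 <= rsum d (fun v => Rabs (f v - g v)) by apply: rsum_ge0 => *; exact: Rabs_pos.
  by rewrite /rsum; lra.
by apply: (Rle_trans _ _ _ h); have := Rabs_pos (f w - g w); rewrite /rsum; lra.
Qed.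

End Near.

(** * The filtration by level and openness tested on prisms *)

Variable level : V -> nat.

Definition low N (c : list V) := forall v, In v c -> (level v <= N)%N.

Definition point_at N (f : V -> R) := is_point f /\ forall v, f v <> 0 -> (level v <= N)%N.

(* Openness of [W] in [D_N x [0,1]], tested on the prisms [c x [0,1]]. *)
Definition sopen N (W : (V -> R) -> R -> Prop) := forall c, is_chain c -> low N c ->
  forall f t, in_simplex c f -> 0 <= t <= 1 -> W f t -> near c f t W.

Fixpoint sublists A (l : list A) : list (list A) :=
  if l is a :: l' then map (cons a) (sublists l') ++ sublists l' else [:: [::]].

Lemma filter_sublists A (p : A -> bool) l : In (List.filter p l) (sublists l).
Proof.
elim: l => [|a l IH] /=; first by left.
apply/in_app_iff; case: (p a); [left|by right].
by apply/in_map_iff; exists (List.filter p l).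
Qed.

Definition pullback (h : (V -> R) -> R -> V -> R) (W : (V -> R) -> R -> Prop) f t := W (h f t) t.

(** Images of nearby points of a prism need not share a simplex. Their supports lie in a finite list
    [L], so each image lies on one of finitely many sublists; openness of [W] on those that are
    simplices containing the support of [p] gives finitely many conditions. *)
Lemma sopen_pullback N N' h W :
  (forall f t, point_at N f -> 0 <= t <= 1 -> point_at N' (h f t)) ->
  (forall c, is_chain c -> low N c -> exists2 L,
     forall f t, in_simplex c f -> 0 <= t <= 1 -> supp_in (h f t) L &
     forall v f t, in_simplex c f -> 0 <= t <= 1 -> cont c f t (fun g s => h g s v)) ->
  sopen N' W -> sopen N (pullback h W).
Proof.
move=> hpt hc oW c ch lc f t fc tI Wft; have [L hL hcont] := hc c ch lc.
have pt g : in_simplex c g -> point_at N g.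
  by move=> [gp gc]; split=> // v /gc /lc.
set p := h f t in Wft.
have [pp pl] : point_at N' p by apply: hpt => //; exact: pt.
(* Near [p] the support can only grow, so sublists missing a vertex of it do not occur. *)
have n1 : near c f t (fun g s => forall v, In v L -> p v <> 0 -> h g s v <> 0).
  apply: near_list => v _; case: (classic (p v = 0)) => pv; first by apply: near_all.
  have pv0 : 0 < p v by have := proj1 pp v; lra.
  apply: near_imp (hcont v f t fc tI _ pv0) => g s _ _ + _ hv.
  by rewrite -/p hv; have := Rabs_cases (0 - p v); lra.
have n2 : near c f t (fun g s => forall d, In d (sublists L) ->
    is_chain d -> low N' d -> supp_in p d -> supp_in (h g s) d -> W (h g s) s).
  apply: near_list => d _.
  case: (classic [/\ is_chain d, low N' d & supp_in p d]) => [[dch ld pd]|nd]; last first.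
    by apply: near_all => g s _ _ *; case: nd.
  have [e [e0 he]] := oW d dch ld p t (conj pp pd) tI Wft.
  have n3 : near c f t (fun g s => sdist d p (h g s) < e).
    have cd : cont c f t (fun g s => sdist d p (h g s)).
      apply: (@cont_rsum c f t d (fun v g s => Rabs (p v - h g s v))) => v.
      apply: (@cont_lip2 c f t (fun a b => Rabs (a - b)) (fun _ _ => p v) (fun g s => h g s v)).
      + move=> a b a' b'; have := Rabs_cases (a - b); have := Rabs_cases (a' - b').
        have := Rabs_cases (a - a'); have := Rabs_cases (b - b').
        by have := Rabs_cases (Rabs (a - b) - Rabs (a' - b')); lra.
      + exact: cont_const.
      + exact: hcont.
    apply: near_imp (cd e e0) => g s _ _; rewrite -/p.
    have -> : sdist d p p = 0.
      by rewrite /sdist -(rsum0 d); apply: rsum_ext => v _; rewrite Rminus_diag Rabs_R0.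
    by have := Rabs_cases (sdist d p (h g s) - 0); lra.
  apply: near_imp (near_and n3 (cont_time c f t e0)) => g s gc sI [h1 h2] _ _ _ hd.
  by apply: he => //; split=> //; have [] := hpt g s (pt _ gc) sI.
apply: near_imp (near_and n1 n2) => g s gc sI [h1 h2].
have [hp hl] := hpt g s (pt _ gc) sI.
have inL v : h g s v <> 0 -> In v (List.filter (nonzero (h g s)) L).
  by move=> hv; apply/filter_In; split; [apply: (hL g s gc sI)|apply/nonzeroP].
apply: (h2 _ (filter_sublists (nonzero (h g s)) L)) => //.
- move=> v w /filter_In [_ /nonzeroP hv] /filter_In [_ /nonzeroP hw].
  by have [_ [d [_ [dch [hd _]]]]] := hp; apply: dch; exact: hd.
- by move=> v /filter_In [_ /nonzeroP /hl].
- by move=> v pv; apply: inL; apply: h1 => //; exact: (hL f t fc tI).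
Qed.

(** Compactness of [a, b], through the supremum of the x for which one radius works on [a, x]. *)
Lemma interval_uniform a b (P : R -> R -> Prop) : a <= b ->
  (forall s e e', 0 < e' <= e -> P s e -> P s e') ->
  (forall s, a <= s <= b -> exists e, 0 < e /\ forall s', a <= s' <= b -> Rabs (s' - s) < e -> P s' e) ->
  exists e, 0 < e /\ forall s, a <= s <= b -> P s e.
Proof.
move=> ab mono loc.
pose A x := a <= x <= b /\ exists e, 0 < e /\ forall s, a <= s <= x -> P s e.
have [e0 [e00 he0]] := loc a (conj (Rle_refl a) ab).
have Aa : A a.
  split; first by lra.
  exists e0; split=> // s sa; apply: he0; first by lra.
  by have := Rabs_cases (s - a); lra.
have [x [xub xlub]] := completeness A (ex_intro _ b (fun y hy => proj2 (proj1 hy))) (ex_intro _ a Aa).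
have ax : a <= x by apply: xub.
have xb : x <= b by apply: xlub => y [[]].
have [e [ep he]] := loc x (conj ax xb).
have [y [[yab [e1 [e1p hy]]] yx]] : exists y, A y /\ x - e < y.
  apply: NNPP => H; have : x <= x - e; last by lra.
  by apply: xlub => y Ay; apply: Rnot_lt_le => h; apply: H; exists y.
have ext z : a <= z <= b -> z < x + e -> A z.
  move=> zab ze; split=> //; exists (Rmin e e1); split; first exact: Rmin_pos.
  have := Rmin_l e e1; have := Rmin_r e e1; have := Rmin_pos _ _ ep e1p => r0 r1 r2 s sz.
  case: (Rle_lt_dec s y) => sy; first by apply: (mono _ e1) => //; apply: hy; lra.
  apply: (mono _ e) => //; apply: he; first by lra.
  by have := Rabs_cases (s - x); lra.
have Ab : A b.
  apply: (ext b); first by lra.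
  case: (Rlt_le_dec b (x + e)) => // h.
  have /xub : A (x + e / 2) by apply: ext; lra.
  by lra.
by case: Ab => _ [r [r0 hr]]; exists r.
Qed.

(** A tube argument. Openness on prisms gives no box directly; the box is built from the set [U] of
    points whose whole segment over [a, b] lies in [W], which is weakly open by compactness of
    [a, b]. *)
Lemma sopen_prod_open W : (forall N, sopen N W) -> prod_open W.
Proof.
move=> oW x t xp tI Wxt.
have oWc c : is_chain c -> forall f s, in_simplex c f -> 0 <= s <= 1 -> W f s -> near c f s W.
  have [N lN] : exists N, low N c.
    elim: c => [|v c [N hN]]; first by exists 0%N => v [].
    exists (maxn (level v) N) => w [<-|/hN h]; first exact: leq_maxl.
    exact: leq_trans h (leq_maxr _ _).
  by move=> ch; exact: oW lN.
have [_ [c [uc [cch [xc c1]]]]] := xp.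
have xin : in_simplex c x by [].
have [e [e0 he]] := oWc c cch x t xin tI Wxt.
(* Half the radius keeps the closed interval [a, b] inside the open one on which [W] is known at
   [x]. *)
pose a := Rmax 0 (t - e / 2); pose b := Rmin 1 (t + e / 2).
have Ha := Rmax_cases 0 (t - e / 2); have Hb := Rmin_cases 1 (t + e / 2).
rewrite -/a in Ha; rewrite -/b in Hb.
pose U y := forall s, a <= s <= b -> W y s.
exists U, (e / 2); split; [|split; [|split; [lra|]]].
- move=> d dch f fd Uf.
  have [|||r [r0 hr]] := @interval_uniform a b (fun s r => forall g, in_simplex d g -> sdist d f g < r -> W g s).
  + by lra.
  + by move=> s r r' rr h g gd dg; apply: h => //; lra.
  + move=> s sab; have [|r [r0 hr]] := oWc d dch f s fd _ (Uf s sab); first by lra.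
    by exists r; split=> // s' s'ab ss' g gd dg; apply: hr => //; lra.
  + by exists r; split=> // g gd dg s sab; exact: hr.
- move=> s sab; apply: he => //; first by lra.
    have -> : sdist c x x = 0; last by [].
    by rewrite /sdist -(rsum0 c); apply: rsum_ext => v _; rewrite Rminus_diag Rabs_R0.
  by have := Rabs_cases (s - t); lra.
- move=> y s yp Uy sI st; apply: Uy; have := Rabs_cases (s - t); lra.
Qed.

Lemma sopen_weak N U : weak_open U -> sopen N (fun f _ => U f).
Proof.
move=> oU c ch _ f t fc tI Uf; have [e [e0 he]] := oU c ch f fc Uf.
by exists e; split=> // g s gc sI dg _; exact: he.
Qed.

(** * The deformation of D_N, from order-theoretic data *)

Variables (base top : V -> V) (trim : V -> V -> V) (v0 : V).
Hypothesis base_base : forall v, base (base v) = base v.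
Hypothesis level_base : forall v, level (base v) = level v.
Hypothesis base_le_self : forall v, vle (base v) v.
Hypothesis level_antitone : forall v w, vle v w -> (level w <= level v)%N.
Hypothesis base_eq : forall v w, vle v w -> level v = level w -> base v = base w.
Hypothesis base_level0 : forall v, level v = 0%N -> base v = v0.
Hypothesis trim_le : forall v w, vle (base v) w -> vle (trim v w) w.
Hypothesis base_le_trim : forall v w, vle (base v) (trim v w).
Hypothesis trim_le_top : forall v w, vle (trim v w) (top v).
Hypothesis base_le_top : forall v, vle (base v) (top v).
Hypothesis trim_mono : forall v u w, vle u w -> vle (trim v u) (trim v w).
Hypothesis level_trim : forall v w, vle (base v) w -> (level w < level v)%N ->
  (level (trim v w) < level v)%N.
Hypothesis level_top : forall v, (0 < level v)%N -> (level (top v) < level v)%N.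

Definition clamp x := Rmax 0 (Rmin 1 x).

Lemma clampP x : (x <= 0 /\ clamp x = 0) \/ (0 <= x <= 1 /\ clamp x = x) \/ (1 <= x /\ clamp x = 1).
Proof. by rewrite /clamp; have := Rmin_cases 1 x; have := Rmax_cases 0 (Rmin 1 x); lra. Qed.

Definition hi (N : nat) (f : V -> R) v : R := if level v == N then f v else 0.
Definition lo (N : nat) (f : V -> R) v : R := if level v == N then 0 else f v.
Definition mass (N : nat) (c : list V) f := rsum c (hi N f).
(** The quota grows up to the mass at level [N] and no further, so the motion dies out on the way to
    D_(N-1). *)
Definition moved (N : nat) c f t := filled (lo N f) (clamp (3 * t - 1) * mass N c f) c.

(* The deformation of [D_N] near a base vertex [b] of level [N], for [t] from 0
   to 1 in three stages of equal length: the mass [a] sitting at level [N] is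
   collected in [b]; an equal amount of the mass below level [N], taken from the
   bottom of the chain, is moved by [trim b]; the mass of [b] is sent to the
   moved masses in proportion, and what exceeds them to [top b]. *)
Definition spread (N : nat) b c f t (u : V) : R :=
  let p1 := clamp (3 * t) in let p3 := clamp (3 * t - 2) in let a := mass N c f in
  (p1 - p3) * a * delta b u + p3 * (a - rsum c (moved N c f t)) * delta (top b) u
  + rsum c (fun v => ((1 - p1) * hi N f v + (lo N f v - moved N c f t v)) * delta v u)
  + rsum c (fun w => (1 + p3) * moved N c f t w * delta (trim b w) u).

Lemma hi_lo N f v : hi N f v + lo N f v = f v.
Proof. rewrite /hi /lo; case: eqP => _; lra. Qed.

Lemma hi_supp N (f : V -> R) c : supp_in f c -> supp_in (hi N f) c.
Proof. by move=> fc v; rewrite /hi; case: eqP => // _ /fc. Qed.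

Lemma lo_supp N (f : V -> R) c : supp_in f c -> supp_in (lo N f) c.
Proof. by move=> fc v; rewrite /lo; case: eqP => // _ /fc. Qed.

Section Stage.
Variables (N : nat) (b : V) (f : V -> R).
Hypothesis f_ge0 : forall v, 0 <= f v.
Hypothesis base_b : base b = b.
Hypothesis level_b : level b = N.

Lemma hi_ge0 v : 0 <= hi N f v. Proof. rewrite /hi; case: eqP => // _; lra. Qed.
Lemma lo_ge0 v : 0 <= lo N f v. Proof. rewrite /lo; case: eqP => // _; lra. Qed.

Lemma mass_ge0 c : 0 <= mass N c f.
Proof. by apply: rsum_ge0 => v _; exact: hi_ge0. Qed.

Lemma quota_ge0 c t : 0 <= clamp (3 * t - 1) * mass N c f.
Proof. by apply: Rmult_le_pos; [have := clampP (3 * t - 1); lra|exact: mass_ge0]. Qed.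

Lemma moved_ge0 c t v : 0 <= moved N c f t v.
Proof. exact: filled_ge0. Qed.

Lemma moved_le c t v : moved N c f t v <= lo N f v.
Proof. exact: filled_le lo_ge0 _ _ _. Qed.

Lemma hi0 v : f v = 0 -> hi N f v = 0.
Proof. by rewrite /hi; case: eqP. Qed.

Lemma lo0 v : f v = 0 -> lo N f v = 0.
Proof. by rewrite /lo; case: eqP. Qed.

Lemma moved0 c t v : f v = 0 -> moved N c f t v = 0.
Proof. by move/lo0 => l0; have := moved_ge0 c t v; have := moved_le c t v; lra. Qed.

Section Chain.
Variable c : list V.
Hypothesis c_uniq : NoDup c.
Hypothesis f_supp : supp_in f c.

Lemma mass_indep d : NoDup d -> supp_in f d -> mass N c f = mass N d f.
Proof. by move=> ud fd; apply: rsum_indep => //; exact: hi_supp. Qed.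

Lemma moved_indep d t v : NoDup d -> supp_in f d -> moved N c f t v = moved N d f t v.
Proof.
move=> ud fd; rewrite /moved /filled (mass_indep ud fd); congr (Rmax _ (Rmin _ (_ - _))).
have supp e : supp_in f e -> supp_in
    (fun u => if excluded_middle_informative (vlt u v) then lo N f u else 0) e.
  by move=> fe u; case: excluded_middle_informative => //= _; exact: lo_supp.
by apply: rsum_indep => //; exact: supp.
Qed.

(** The lists enter only through sums of terms that vanish with [f]. *)
Lemma spread_indep d t : NoDup d -> supp_in f d -> spread N b c f t = spread N b d f t.
Proof.
move=> ud fd; apply: functional_extensionality => u; rewrite /spread (mass_indep ud fd).
have -> : moved N c f t = moved N d f t.
  by apply: functional_extensionality => v; exact: moved_indep.
have indep g : (forall v, f v = 0 -> g v = 0) -> rsum c g = rsum d g.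
  move=> g0; apply: rsum_indep => // v gv; [apply: f_supp|apply: fd] => fv;
    by apply: gv; exact: g0.
rewrite (indep (moved N d f t)) ?(indep (fun v => _ * delta v u)) ?(indep (fun w => _ * delta (trim b w) u)) //.
- by move=> v fv; rewrite moved0 //; lra.
- by move=> v fv; rewrite moved0 // hi0 // lo0 //; lra.
- by move=> v; exact: moved0.
Qed.

Hypothesis c_chain : is_chain c.
Hypothesis c_base : forall v, In v c -> vle b v.
Variable t : R.

Local Notation p1 := (clamp (3 * t)).
Local Notation p2 := (clamp (3 * t - 1)).
Local Notation p3 := (clamp (3 * t - 2)).
Local Notation a := (mass N c f).
Local Notation C := (moved N c f t).

(** The three clocks run one after another: each starts when the previous one has reached 1. *)
Lemma stage_cases :
  [\/ p2 = 0 /\ p3 = 0, p1 = 1 /\ p3 = 0 | p1 = 1 /\ p2 = 1].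
Proof.
have := clampP (3 * t); have := clampP (3 * t - 1); have := clampP (3 * t - 2) => h3 h2 h1.
case: (Rle_lt_dec (3 * t) 1) => ?; first by constructor 1; lra.
case: (Rle_lt_dec (3 * t) 2) => ?; first by constructor 2; lra.
by constructor 3; lra.
Qed.

Lemma rsum_moved : rsum c C = Rmin (p2 * a) (rsum c (lo N f)).
Proof. exact: (rsum_filled lo_ge0 (quota_ge0 c t)). Qed.

Lemma rsum_moved_le : rsum c C <= a.
Proof.
have h1 := clampP (3 * t - 1); have h2 := mass_ge0 c.
by have := rsum_moved; have := Rmin_l (p2 * a) (rsum c (lo N f)); nra.
Qed.

Lemma spread_ge0 u : 0 <= spread N b c f t u.
Proof.
have h1 := clampP (3 * t); have h2 := clampP (3 * t - 1); have h3 := clampP (3 * t - 2).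
have ha := mass_ge0 c; have hs := rsum_moved_le.
rewrite /spread; do 3?[apply: Rplus_le_le_0_compat].
- by apply: Rmult_le_pos (delta_ge0 _ _); apply: Rmult_le_pos ha; lra.
- by apply: Rmult_le_pos (delta_ge0 _ _); apply: Rmult_le_pos; lra.
- apply: rsum_ge0 => v _; apply: Rmult_le_pos (delta_ge0 _ _).
  have := moved_le c t v; have : 0 <= (1 - p1) * hi N f v; last by lra.
  by apply: Rmult_le_pos (hi_ge0 v); lra.
- apply: rsum_ge0 => v _; apply: Rmult_le_pos (delta_ge0 _ _).
  by apply: Rmult_le_pos (moved_ge0 c t v); lra.
Qed.

Lemma spread_cases u : spread N b c f t u <> 0 ->
  [\/ u = b /\ (p1 - p3) * a <> 0, u = top b /\ p3 * (a - rsum c C) <> 0,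
   In u c /\ (1 - p1) * hi N f u + (lo N f u - C u) <> 0 |
   exists w, [/\ In w c, C w <> 0 & u = trim b w]].
Proof.
move=> hu.
have prod0 x y : x * y <> 0 -> x <> 0 /\ y <> 0 by move=> h; split=> e; apply: h; rewrite e; ring.
have [h|h] := classic ((p1 - p3) * a * delta b u = 0); last first.
  by have [? /delta_neq0 <-] := prod0 _ _ h; constructor 1.
have [h'|h'] := classic (p3 * (a - rsum c C) * delta (top b) u = 0); last first.
  by have [? /delta_neq0 <-] := prod0 _ _ h'; constructor 2.
have [k|k] := classic (rsum c (fun v => ((1 - p1) * hi N f v + (lo N f v - C v)) * delta v u) = 0); last first.
  by have [v vc /prod0 [? /delta_neq0 vu]] := rsum_neq0 k; subst v; constructor 3.
have [k'|k'] := classic (rsum c (fun w => (1 + p3) * C w * delta (trim b w) u) = 0); last first.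
  have [w wc /prod0 [/prod0 [_ ?] /delta_neq0 wu]] := rsum_neq0 k'.
  by constructor 4; exists w.
by case: hu; rewrite /spread h h' k k'; lra.
Qed.

Definition spread_range := b :: top b :: c ++ map (trim b) c.

Lemma spread_supp : supp_in (spread N b c f t) spread_range.
Proof.
move=> u /spread_cases [[-> _]|[-> _]|[uc _]|[w [wc _ ->]]].
- by left.
- by right; left.
- by right; right; apply/in_app_iff; left.
- by right; right; apply/in_app_iff; right; exact: in_map.
Qed.

(** What [p3] takes away from the term of [top b] is what it adds to the trimmed vertices; the other
    weights add up to the total mass. *)
Lemma spread_total L : NoDup L -> (forall u, In u spread_range -> In u L) ->
  rsum L (spread N b c f t) = rsum c f.
Proof.
move=> uL inL.
rewrite /spread !rsum_plus !(@rsum_delta L _ (fun=> _)) //; try by apply: inL; rewrite /spread_range /=; auto.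
rewrite !rsum_push //; try by move=> v vc; apply: inL; right; right; apply/in_app_iff; auto using in_map.
rewrite rsum_plus !rsum_scal /Rminus rsum_plus.
have -> : rsum c (fun v => - C v) = - rsum c C.
  by rewrite -[RHS]Rmult_1_l -Ropp_mult_distr_r Ropp_mult_distr_l -rsum_scal; apply: rsum_ext => v _; lra.
have <- : rsum c (hi N f) + rsum c (lo N f) = rsum c f.
  by rewrite -rsum_plus; apply: rsum_ext => v _; exact: hi_lo.
rewrite -/(mass N c f); ring.
Qed.

(** [top b] is charged only in stage three, and only if the full quota exceeds the mass below level
    [N]; the filling has then taken all of that mass. *)
Lemma quota_saturated : p3 * (a - rsum c C) <> 0 ->
  p1 = 1 /\ forall v, In v c -> C v = lo N f v.
Proof.
move=> h; case: stage_cases => [[_ p30]|[_ p30]|[-> p21]]; try by case: h; rewrite p30; ring.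
split=> // v vc.
have sC := rsum_moved; rewrite p21 Rmult_1_l in sC.
have e : rsum c (fun v => lo N f v + (-1) * C v) = 0.
  rewrite rsum_plus rsum_scal; have := Rmin_cases a (rsum c (lo N f)); rewrite -sC.
  by case=> [[_ e]|[_ e]]; [case: h; rewrite e; ring|lra].
have := @rsum_eq0 c (fun v => lo N f v + (-1) * C v) _ e v vc.
suff H w : In w c -> 0 <= lo N f w + (-1) * C w by move/(_ H); lra.
by move=> _; have := moved_le c t w; lra.
Qed.

Lemma spread_base u : spread N b c f t u <> 0 -> vle b u.
Proof.
move=> /spread_cases [[-> _]|[-> _]|[/c_base //]|[w [wc _ ->]]].
- exact: vle_refl.
- by rewrite -{1}base_b; exact: base_le_top.
- by rewrite -{1}base_b; exact: base_le_trim.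
Qed.

Lemma spread_below_top u : p3 * (a - rsum c C) <> 0 -> spread N b c f t u <> 0 -> vle u (top b).
Proof.
move=> /quota_saturated [p11 full] /spread_cases [[-> _]|[-> _]|[uc]|[w [wc _ ->]]].
- by rewrite -{1}base_b; exact: base_le_top.
- exact: vle_refl.
- by rewrite p11 full //; case; ring.
- exact: trim_le_top.
Qed.

(** This is where filling from the bottom counts: a vertex strictly below some [w] with moved mass
    has lost all its mass. So [w] is below [v], and trim b w <= trim b v <= v. *)
Lemma spread_keep_trim v w : In v c -> (1 - p1) * hi N f v + (lo N f v - C v) <> 0 ->
  In w c -> C w <> 0 -> vle (trim b w) v.
Proof.
move=> vc hv wc Cw; have wv : vle w v.
  case: (c_chain vc wc) => // vw; case: (classic (v = w)) => [-> //|vnw].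
  (* Mass at level [N] stays put only before [p1] reaches 1, and until then nothing is moved. *)
  have p2n : p2 <> 0.
    move=> p20; have := rsum_moved; rewrite p20 Rmult_0_l Rmin_left; last first.
      by apply: rsum_ge0 => *; exact: lo_ge0.
    by move/(rsum_eq0 (fun v _ => moved_ge0 c t v)) => /(_ w wc).
  have p11 : p1 = 1 by case: stage_cases => [[]|[]|[]].
  case: hv; have -> : C v = lo N f v by exact: (filled_full lo_ge0 c_uniq vc (conj vw vnw) Cw).
  by rewrite p11; ring.
by move=> x /(trim_mono wv) /(@trim_le b v); apply; rewrite base_b; exact: c_base.
Qed.

Lemma spread_chain u u' : spread N b c f t u <> 0 -> spread N b c f t u' <> 0 ->
  vle u u' \/ vle u' u.
Proof.
move=> hu hu'.
case: (spread_cases hu) => [[-> _]|[-> h]|[uc h]|[w [wc Cw ->]]].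
- by left; exact: spread_base.
- by right; exact: spread_below_top.
- case: (spread_cases hu') => [[-> _]|[-> h']|[uc' _]|[w' [wc' Cw' ->]]].
  + by right; exact: spread_base.
  + by left; exact: spread_below_top.
  + exact: c_chain.
  + by right; exact: spread_keep_trim.
- case: (spread_cases hu') => [[-> _]|[-> h']|[uc' h']|[w' [wc' Cw' ->]]].
  + by right; rewrite -{1}base_b; exact: base_le_trim.
  + by left; exact: trim_le_top.
  + by left; exact: spread_keep_trim.
  + by case: (c_chain wc wc') => /(trim_mono (v := b)); [left|right].
Qed.

Lemma spread_level u : spread N b c f t u <> 0 -> (level u <= N)%N.
Proof. by move/spread_base/level_antitone; rewrite level_b. Qed.

Lemma spread_point : rsum c f = 1 -> is_point (spread N b c f t).
Proof.
move=> f1; split; first exact: spread_ge0.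
pose L := nodup (fun v w => vdec v w) spread_range.
have uL : NoDup L by exact: NoDup_nodup.
have rL u : In u spread_range -> In u L by move=> ?; apply/nodup_In.
exists (List.filter (nonzero (spread N b c f t)) L); split; last split; last split.
- exact: NoDup_filter.
- by move=> v w /filter_In [_ /nonzeroP hv] /filter_In [_ /nonzeroP hw]; exact: spread_chain.
- by move=> v hv; apply/filter_In; split; [apply: rL; exact: spread_supp|apply/nonzeroP].
- by rewrite -rsum_filter spread_total.
Qed.

(** Either condition makes the quota zero. Mass 0 at level [N] is the case of points of D_(N-1),
    which therefore stay fixed. *)
Lemma spread_id : a = 0 \/ t = 0 -> spread N b c f t = f.
Proof.
move=> h; apply: functional_extensionality => u.
have qa : p2 * a = 0.
  case: h => [->|->]; first by ring.
  have -> : clamp (3 * 0 - 1) = 0 by have := clampP (3 * 0 - 1); lra.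
  ring.
have C0 v : In v c -> C v = 0.
  apply: (rsum_eq0 (fun v _ => moved_ge0 c t v)); rewrite rsum_moved qa Rmin_left //.
  by apply: rsum_ge0 => *; exact: lo_ge0.
have ha : (p1 - p3) * a = 0 /\ p3 * a = 0 /\ forall v, In v c -> (1 - p1) * hi N f v = hi N f v.
  case: h => [e|->].
    rewrite e; split; [ring|split; [ring|]] => v vc.
    have -> : hi N f v = 0 by apply: (rsum_eq0 (fun v _ => hi_ge0 v) e).
    ring.
  have -> : clamp (3 * 0) = 0 by have := clampP (3 * 0); lra.
  have -> : clamp (3 * 0 - 2) = 0 by have := clampP (3 * 0 - 2); lra.
  by split; [ring|split; [ring|move=> *; ring]].
have [h1 [h2 h3]] := ha.
have sC : rsum c C = 0 by rewrite -(rsum0 c); apply: rsum_ext => v; exact: C0.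
rewrite /spread h1 sC Rminus_0_r h2.
have -> : rsum c (fun w => (1 + p3) * C w * delta (trim b w) u) = 0.
  by rewrite -(rsum0 c); apply: rsum_ext => w wc; rewrite C0 //; ring.
rewrite -[RHS](rsum_fdelta u c_uniq f_supp) (_ : rsum c _ = rsum c (fun v => f v * delta v u)); first by ring.
by apply: rsum_ext => v vc; rewrite h3 // C0 // -(hi_lo N f v); ring.
Qed.

(** At the end [b] is empty, the kept mass was already below level [N], and [top b] and the trimmed
    vertices have lower level than [b]. *)
Lemma spread_end_level u : t = 1 -> (0 < N)%N -> spread N b c f t u <> 0 -> (level u < N)%N.
Proof.
move=> t1 N0 hu.
have e1 : p1 = 1 by have := clampP (3 * t); lra.
have e3 : p3 = 1 by have := clampP (3 * t - 2); lra.
have lt_of v : lo N f v <> 0 -> In v c -> (level v < N)%N.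
  rewrite /lo; case: eqP => // /eqP ne _ /c_base /level_antitone.
  by rewrite level_b ltn_neqAle ne.
case: (spread_cases hu) => [[_ h]|[-> _]|[uc h]|[w [wc Cw ->]]].
- by case: h; rewrite e1 e3; ring.
- by rewrite -level_b; apply: level_top; rewrite level_b.
- apply: lt_of => // l0; apply: h; rewrite e1.
  by have := moved_ge0 c t u; have := moved_le c t u; lra.
- rewrite -level_b; apply: level_trim; first by rewrite base_b; exact: c_base.
  rewrite level_b; apply: lt_of => // l0; apply: Cw.
  by have := moved_ge0 c t w; have := moved_le c t w; lra.
Qed.
End Chain.
End Stage.

(** A vertex of the chain below [v] has level at least [N], hence exactly [N], and so shares the
    base of [v]. *)
Lemma chain_base N c v : is_chain c -> low N c -> In v c -> level v = N ->
  forall w, In w c -> vle (base v) w.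
Proof.
move=> ch lc vc lv w wc; case: (ch v w vc wc) => vw.
  exact: (vle_trans (@base_le_self v) vw).
have lw : level w = level v.
  by apply/eqP; rewrite eqn_leq (level_antitone vw) lv lc.
by rewrite -(base_eq vw lw); exact: base_le_self.
Qed.

Lemma carrier_exists N f : point_at N f -> exists c,
  [/\ NoDup c, is_chain c, low N c, in_simplex c f & rsum c f = 1].
Proof.
move=> [fp fl]; move: (fp) => [_ [c [uc [ch [fc c1]]]]].
exists (List.filter (nonzero f) c); split.
- exact: NoDup_filter.
- by move=> v w /filter_In [vc _] /filter_In [wc _]; exact: ch.
- by move=> v /filter_In [_ /nonzeroP]; exact: fl.
- by split=> // v fv; apply/filter_In; split; [exact: fc|exact/nonzeroP].
- by rewrite -rsum_filter.
Qed.

Definition carrier N f : list V := epsilon (inhabits [::]) (fun c =>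
  [/\ NoDup c, is_chain c, low N c, in_simplex c f & rsum c f = 1]).

Lemma carrierP N f : point_at N f ->
  [/\ NoDup (carrier N f), is_chain (carrier N f), low N (carrier N f),
    in_simplex (carrier N f) f & rsum (carrier N f) f = 1].
Proof. by move=> /carrier_exists; exact: epsilon_spec. Qed.

(** The vertex of level [N] and the carrier are arbitrary choices, harmless by [base_eq] and
    [spread_indep]. *)
Definition retr N f t : V -> R :=
  if excluded_middle_informative (exists v, f v <> 0 /\ level v = N) is left h
  then spread N (base (proj1_sig (constructive_indefinite_description _ h))) (carrier N f) f t
  else f.

Lemma low_point N c f : low N c -> in_simplex c f -> point_at N f.
Proof. by move=> lc [fp fc]; split=> // v /fc /lc. Qed.

Lemma spread_trivial N b c f t : (forall v, 0 <= f v) -> NoDup c -> is_chain c ->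
  supp_in f c -> (forall v, f v <> 0 -> level v <> N) -> spread N b c f t = f.
Proof.
move=> f0 uc ch fc H; apply: spread_id => //; left.
rewrite /mass -(rsum0 c); apply: rsum_ext => v _; rewrite /hi; case: eqP => // lv.
by apply: NNPP => /H.
Qed.

(** A single formula on a whole closed simplex with a vertex of level [N], including its faces
    without mass at level [N]; continuity of [retr] rests on this. *)
Lemma retr_spread N c v f t : is_chain c -> NoDup c -> low N c -> In v c -> level v = N ->
  in_simplex c f -> retr N f t = spread N (base v) c f t.
Proof.
move=> ch uc lc vc lv fc; have fN := low_point lc fc.
have [f0 _] := proj1 fN.
have lbv : level (base v) = N by rewrite level_base.
rewrite /retr; case: excluded_middle_informative => [h|h]; last first.
  by rewrite spread_trivial //; [exact: (proj2 fc)|move=> w fw lw; apply: h; exists w].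
case: constructive_indefinite_description => w [fw lw] /=.
have wc : In w c by case: fc => _; exact.
have -> : base w = base v.
  have e : level w = level v by rewrite lw lv.
  by case: (ch w v wc vc) => /base_eq h1; [exact: h1|apply: esym; apply: h1].
have [ud _ _ [_ fd] _] := carrierP fN.
by apply: spread_indep => //; exact: (proj2 fc).
Qed.

Lemma retr_id N f t : (forall v, f v <> 0 -> level v <> N) -> retr N f t = f.
Proof.
move=> H; rewrite /retr; case: excluded_middle_informative => // -[v [fv lv]].
by case: (H v fv).
Qed.

Lemma retr_dec N f : point_at N f ->
  (forall t, retr N f t = f) /\ (forall v, f v <> 0 -> (level v < N)%N) \/
  exists c b, [/\ (forall t, retr N f t = spread N b c f t), base b = b /\ level b = N,
    NoDup c, is_chain c & [/\ supp_in f c, (forall v, In v c -> vle b v) & rsum c f = 1]].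
Proof.
move=> fN; have [uc ch lc fc c1] := carrierP fN.
case: (classic (exists v, f v <> 0 /\ level v = N)) => [[v [fv lv]]|h]; last first.
  have H v : f v <> 0 -> level v <> N by move=> fv lv; apply: h; exists v.
  left; split=> [t|v fv]; first exact: retr_id.
  by rewrite ltn_neqAle (proj2 fN) // andbT; apply/eqP; exact: H.
have vc : In v (carrier N f) by apply: (proj2 fc).
right; exists (carrier N f), (base v); split=> //.
- by move=> t; exact: retr_spread.
- by rewrite base_base level_base.
- split=> //; first exact: (proj2 fc).
  exact: chain_base ch lc vc lv.
Qed.

Lemma retr_point N f t : point_at N f -> point_at N (retr N f t).
Proof.
move=> fN; case: (retr_dec fN) => [[-> _]//|[c [b [-> [bb lb] uc ch [fc cb c1]]]]].
have [f0 _] := proj1 fN; split; first exact: spread_point.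
by move=> v; exact: spread_level.
Qed.

Lemma retr_end N f : point_at N.+1 f -> point_at N (retr N.+1 f 1).
Proof.
move=> fN; have [rp _] := retr_point 1 fN; split=> // v; move: rp.
case: (retr_dec fN) => [[-> lt] _ /lt //|[c [b [-> [bb lb] uc ch [fc cb c1]]]] _ hv].
have [f0 _] := proj1 fN.
by rewrite -ltnS; exact: (spread_end_level f0 bb lb cb (erefl 1) _ hv).
Qed.

Lemma retr_start N f : point_at N f -> retr N f 0 = f.
Proof.
move=> fN; case: (retr_dec fN) => [[-> _]//|[c [b [-> [bb lb] uc ch [fc cb c1]]]]].
have [f0 _] := proj1 fN; by apply: spread_id => //; right.
Qed.

Lemma retr_below N f t : point_at N f -> retr N.+1 f t = f.
Proof. by move=> fN; apply: retr_id => v /(proj2 fN) lv e; rewrite e ltnn in lv. Qed.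

(** In D_0 all mass has level 0 and all bases are [v0], so stage one alone gathers everything there.
    It ends at time 1/3, whence the division by 3 in [contr]. *)
Lemma retr_cone f : point_at 0 f -> retr 0 f (1 / 3) = delta v0.
Proof.
move=> fN; have [f0 _] := proj1 fN.
case: (retr_dec fN) => [[_ h]|[c [b [-> [bb lb] uc ch [fc cb c1]]]]].
  have [_ [c [_ [_ [_ c1]]]]] := proj1 fN.
  have [|v _ /h //] := @rsum_neq0 c f; first by rewrite c1; lra.
have b0 : b = v0 by rewrite -bb; exact: base_level0.
have lo0' v : lo 0 f v = 0.
  rewrite /lo; case: eqP => // lv; apply: NNPP => /(proj2 fN).
  by rewrite leqn0 => /eqP.
have C0 v : moved 0 c f (1 / 3) v = 0.
  by have := moved_ge0 0 f c (1 / 3) v; have := @moved_le 0 f f0 c (1 / 3) v; rewrite lo0'; lra.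
apply: functional_extensionality => u; rewrite /spread.
have -> : clamp (3 * (1 / 3)) = 1 by have := clampP (3 * (1 / 3)); lra.
have -> : clamp (3 * (1 / 3) - 2) = 0 by have := clampP (3 * (1 / 3) - 2); lra.
have -> : mass 0 c f = 1.
  by rewrite -c1; apply: rsum_ext => v _; rewrite -[RHS](hi_lo 0) lo0'; lra.
rewrite -b0 [X in _ + X + _](_ : _ = 0); last first.
  by rewrite -(rsum0 c); apply: rsum_ext => v _; rewrite lo0' C0; ring.
rewrite [X in _ + X = _](_ : _ = 0); first by ring.
by rewrite -(rsum0 c); apply: rsum_ext => v _; rewrite C0; ring.
Qed.

Lemma cont_clamp c f t p : cont c f t p -> cont c f t (fun g s => clamp (p g s)).
Proof.
move=> hp; apply: cont_max; first exact: cont_const.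
by apply: cont_min => //; exact: cont_const.
Qed.

Lemma cont_filled c f t d (x : (V -> R) -> V -> R) K w :
  (forall v, cont c f t (fun g _ => x g v)) -> cont c f t K ->
  cont c f t (fun g s => filled (x g) (K g s) d w).
Proof.
move=> hx hK; apply: cont_max; first exact: cont_const.
apply: cont_min => //; apply: cont_minus => //.
apply: (@cont_rsum c f t d (fun u g _ => if excluded_middle_informative (vlt u w) then x g u else 0)) => u.
case: excluded_middle_informative => ? /=; [exact: hx|exact: cont_const].
Qed.

Lemma cont_spread N b d c f t tau u : in_simplex c f -> cont c f t (fun _ s => tau s) ->
  cont c f t (fun g s => spread N b d g (tau s) u).
Proof.
move=> fc ht.
have hlo v : cont c f t (fun g _ => lo N g v).
  by rewrite /lo; case: eqP => _; [exact: cont_const|exact: cont_coord].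
have hhi v : cont c f t (fun g _ => hi N g v).
  by rewrite /hi; case: eqP => _; [exact: cont_coord|exact: cont_const].
have hm : cont c f t (fun g _ => mass N d g) by exact: (@cont_rsum c f t d (fun v g _ => hi N g v)).
have hp k : cont c f t (fun _ s => clamp (3 * tau s - k)).
  apply: (@cont_clamp c f t (fun _ s => 3 * tau s - k)).
  apply: cont_minus; last exact: cont_const.
  by apply: cont_mult => //; exact: cont_const.
have hp1 : cont c f t (fun _ s => clamp (3 * tau s)).
  apply: (@cont_clamp c f t (fun _ s => 3 * tau s)).
  by apply: cont_mult => //; exact: cont_const.
have hC v : cont c f t (fun g s => moved N d g (tau s) v).
  apply: (@cont_filled c f t d (lo N) (fun g s => clamp (3 * tau s - 1) * mass N d g)) => //.
  by apply: cont_mult.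
rewrite /spread; do 3?apply: cont_plus.
- apply: cont_mult; last exact: cont_const.
  by apply: cont_mult => //; apply: cont_minus.
- apply: cont_mult; last exact: cont_const.
  apply: cont_mult => //; apply: cont_minus => //.
  exact: (@cont_rsum c f t d (fun v g s => moved N d g (tau s) v)).
- apply: (@cont_rsum c f t d (fun v g s => ((1 - clamp (3 * tau s)) * hi N g v +
    (lo N g v - moved N d g (tau s) v)) * delta v u)) => v.
  apply: cont_mult; last exact: cont_const.
  apply: cont_plus; last by apply: cont_minus.
  by apply: cont_mult => //; apply: cont_minus => //; exact: cont_const.
- apply: (@cont_rsum c f t d (fun w g s => (1 + clamp (3 * tau s - 2)) * moved N d g (tau s) w *
    delta (trim b w) u)) => w.
  apply: cont_mult; last exact: cont_const.
  by apply: cont_mult => //; apply: cont_plus => //; exact: cont_const.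
Qed.

Lemma sopen_retr N N' tau W :
  (forall f t, point_at N f -> 0 <= t <= 1 -> point_at N' (retr N f (tau t))) ->
  (forall c f t, cont c f t (fun _ s => tau s)) ->
  sopen N' W -> sopen N (pullback (fun f t => retr N f (tau t)) W).
Proof.
move=> hp ht; apply: sopen_pullback => // c ch lc.
case: (classic (exists2 v, In v c & level v = N)) => [[v vc lv]|h]; last first.
  have rE f t : in_simplex c f -> retr N f (tau t) = f.
    by move=> [_ fc]; apply: retr_id => v /fc vc lv; apply: h; exists v.
  exists c => [f t fc tI|v f t fc tI]; first by rewrite rE //; exact: (proj2 fc).
  by apply: (cont_ext fc tI _ (cont_coord t v fc)) => g s gc _; rewrite rE.
(* [is_chain] tolerates repetitions, which the sums in [spread] would count twice. *)
pose d := nodup (fun v w => vdec v w) c.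
have dc w : In w d <-> In w c by exact: nodup_In.
have ud : NoDup d by exact: NoDup_nodup.
have dch : is_chain d by move=> x y /dc xc /dc; exact: ch.
have ld : low N d by move=> w /dc; exact: lc.
have sub f : in_simplex c f -> in_simplex d f.
  by move=> [fp fc]; split=> // w /fc /dc.
have rE f t : in_simplex c f -> retr N f (tau t) = spread N (base v) d f (tau t).
  by move=> fc; apply: (retr_spread _ dch ud ld _ lv (sub _ fc)); apply/dc.
exists (spread_range (base v) d) => [f t fc tI|w f t fc tI].
  by rewrite rE //; apply: spread_supp.
by apply: (cont_ext fc tI _ (cont_spread N (base v) d w fc (ht c f t))) => g s gc _; rewrite rE.
Qed.

(** * Composing the retractions into one contraction *)

Lemma point_low N f : point_at N f -> point_at N.+1 f.
Proof. by move=> [fp fl]; split=> // v /fl /leqW. Qed.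

(* [phi N] runs from 0 to 1 while [t] runs from [2^-(N+1)] to [2^-N]. *)
Definition phi N t := clamp (2 ^ N.+1 * t - 1).

(* The retractions [D_N -> D_(N-1) -> ... -> D_0 -> v0], the one of [D_N] being
   performed during the interval [2^-(N+1), 2^-N]. *)
Fixpoint contr N f t : V -> R :=
  if N is N'.+1 then
    if Rle_dec (2 ^ N * t) 1 then retr N f (phi N t) else contr N' (retr N f 1) t
  else retr 0 f (phi 0 t / 3).

Lemma contrS_early N f t : 2 ^ N.+1 * t <= 1 -> contr N.+1 f t = retr N.+1 f (phi N.+1 t).
Proof. by rewrite /contr; case: Rle_dec. Qed.

Lemma contrS_late N f t : 1 < 2 ^ N.+1 * t -> contr N.+1 f t = contr N (retr N.+1 f 1) t.
Proof. by rewrite [LHS]/contr; case: Rle_dec => // h h'; lra. Qed.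

Lemma phi_early N t : 2 ^ N.+1 * t <= 1 -> phi N t = 0.
Proof. by rewrite /phi => h; have := clampP (2 ^ N.+1 * t - 1); lra. Qed.

Lemma pow2_ge1 N : 1 <= 2 ^ N.
Proof. by apply: pow_R1_Rle; lra. Qed.

Lemma pow2S N t : 2 ^ N.+1 * t = 2 * (2 ^ N * t).
Proof. by rewrite -tech_pow_Rmult; ring. Qed.

Lemma contr_early N f t : point_at N f -> 0 <= t -> 2 ^ N.+1 * t <= 1 -> contr N f t = f.
Proof.
move=> fN t0 ht; have pe := phi_early ht; case: N fN ht pe => [|N] fN ht pe.
  by rewrite /contr pe Rdiv_0_l; exact: retr_start.
have h0 : 0 <= 2 ^ N.+1 * t by apply: Rmult_le_pos => //; have := pow2_ge1 N.+1; lra.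
rewrite contrS_early; first by rewrite pe; exact: retr_start.
by move: ht; rewrite (pow2S N.+1); lra.
Qed.

(** [retr N.+1] is stationary on D_N, and points of D_N wait until time 2^-(N+1); so the
    contractions of the D_N agree on overlaps and define one homotopy. *)
Lemma contr_low N f t : point_at N f -> 0 <= t -> contr N.+1 f t = contr N f t.
Proof.
move=> fN t0; have [h|h] := Rle_lt_dec (2 ^ N.+1 * t) 1.
  by rewrite contrS_early // retr_below // contr_early.
by rewrite contrS_late // retr_below.
Qed.

Lemma contr_point N f t : point_at N f -> point_at N (contr N f t).
Proof.
elim: N f => [|N IH] f fN; first exact: retr_point.
have [h|h] := Rle_lt_dec (2 ^ N.+1 * t) 1.
  by rewrite contrS_early //; exact: retr_point.
by rewrite contrS_late //; apply: point_low; apply: IH; exact: retr_end.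
Qed.

Lemma contr_end N f : point_at N f -> contr N f 1 = delta v0.
Proof.
elim: N f => [|N IH] f fN.
  by rewrite /= /phi (_ : clamp _ = 1) ?retr_cone //; have := clampP (2 ^ 1 * 1 - 1); rewrite /=; lra.
rewrite contrS_late; first by apply: IH; exact: retr_end.
by rewrite pow2S; have := pow2_ge1 N; lra.
Qed.

Lemma cont_phi N c f t : cont c f t (fun _ s => phi N s).
Proof.
apply: (@cont_clamp c f t (fun _ s => 2 ^ N.+1 * s - 1)).
apply: cont_minus; last exact: cont_const.
by apply: cont_mult; [exact: cont_const|exact: cont_time].
Qed.

Lemma sopen_low N W : sopen N.+1 W -> sopen N W.
Proof. by move=> oW c ch lc; apply: oW => // v /lc /leqW. Qed.

Lemma sopen_contr N W : sopen N W -> sopen N (pullback (contr N) W).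
Proof.
elim: N W => [|N IH] W oW.
  apply: (@sopen_retr 0 0 (fun t => phi 0 t / 3)) => // [f t fN _|c f t]; first exact: retr_point.
  by apply: cont_mult; [exact: cont_phi|exact: cont_const].
have oA : sopen N.+1 (pullback (fun f t => retr N.+1 f (phi N.+1 t)) W).
  by apply: (@sopen_retr N.+1 N.+1) => // [f t fN _|c f t]; [exact: retr_point|exact: cont_phi].
have oB : sopen N.+1 (pullback (fun f t => retr N.+1 f 1) (pullback (contr N) W)).
  apply: (@sopen_retr N.+1 N (fun=> 1)); [|by move=> *; exact: cont_const|].
    by move=> f t fN _; exact: retr_end.
  by apply: IH; exact: sopen_low.
move=> c ch lc f t fc tI.
have fN := low_point lc fc.
have ct : cont c f t (fun _ s => 2 ^ N.+1 * s).
  by apply: cont_mult; [exact: cont_const|exact: cont_time].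
have [h|[h|h]] := Rtotal_order (2 ^ N.+1 * t) 1.
- rewrite {1}/pullback contrS_early; last by lra.
  move=> /(oA c ch lc f t fc tI) nA; have e0 : 0 < 1 - 2 ^ N.+1 * t by lra.
  apply: near_imp (near_and nA (ct _ e0)) => g s _ _ [Ag hs].
  rewrite /pullback contrS_early //.
  by have := Rabs_cases (2 ^ N.+1 * s - 2 ^ N.+1 * t); lra.
(* At the junction the early formula has reached [retr N.+1 f 1], where the late one starts. Nearby
   times fall on either side, so both neighbourhoods are intersected. *)
- have e1 : phi N.+1 t = 1.
    rewrite /phi pow2S h; have := clampP (2 * 1 - 1); lra.
  have rN := retr_end fN.
  rewrite {1}/pullback contrS_early ?h => [Wft|]; last by lra.
  have nA : near c f t (pullback (fun f t => retr N.+1 f (phi N.+1 t)) W) by exact: oA.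
  have nB : near c f t (pullback (fun f t => retr N.+1 f 1) (pullback (contr N) W)).
    apply: oB => //; rewrite /pullback contr_early ?h //; [by rewrite -e1|lra|lra].
  apply: near_imp (near_and nA nB) => g s _ _ [Ag Bg].
  rewrite /pullback; have [h'|h'] := Rle_lt_dec (2 ^ N.+1 * s) 1.
    by rewrite contrS_early.
  by rewrite contrS_late.
- rewrite {1}/pullback contrS_late //.
  move=> /(oB c ch lc f t fc tI) nB; have e0 : 0 < 2 ^ N.+1 * t - 1 by lra.
  apply: near_imp (near_and nB (ct _ e0)) => g s _ _ [Bg hs].
  rewrite /pullback contrS_late //.
  by have := Rabs_cases (2 ^ N.+1 * s - 2 ^ N.+1 * t); lra.
Qed.

Lemma point_bounded f : is_point f -> exists N, point_at N f.
Proof.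
move=> fp; case: (fp) => _ [c [_ [_ [fc _]]]].
suff [N H] : exists N, low N c by exists N; split=> // v /fc /H.
elim: c {fc} => [|v c [N hN]]; first by exists 0%N => v [].
exists (maxn (level v) N) => w [<-|/hN h]; first exact: leq_maxl.
exact: leq_trans h (leq_maxr _ _).
Qed.

Definition bound f := epsilon (inhabits 0%N) (fun N => point_at N f).

Lemma contr_bound N f t : point_at N f -> 0 <= t -> contr (bound f) f t = contr N f t.
Proof.
move=> fN t0.
have fb : point_at (bound f) f.
  exact: (epsilon_spec (inhabits 0%N) (fun N => point_at N f) (ex_intro _ N fN)).
have up k M : point_at M f -> contr (k + M) f t = contr M f t.
  move=> fM; elim: k => // k <-; apply: contr_low => //.
  by elim: k => // k IHk; exact: point_low.
case: (leqP N (bound f)) => [/subnK <-|/ltnW /subnK <-]; first exact: up.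
by rewrite up.
Qed.

(** Each prism lies over a simplex of some D_N, where only finitely many retractions act; this
    settles continuity at time 0 as well. *)
Lemma contractible_of_retraction : contractible_realization E m.
Proof.
exists (delta v0), (fun f t => contr (bound f) f t); split; [|split; [|split]].
- split; first exact: delta_ge0.
  exists [:: v0]; split; first by constructor=> //; constructor.
  split; first by move=> v w [<-|[]] [<-|[]]; left; exact: vle_refl.
  split; first by move=> v /delta_neq0 <-; left.
  by rewrite /= deltavv; lra.
- move=> f t fp [t0 _]; have [N fN] := point_bounded fp.
  by rewrite (contr_bound fN t0); exact: (proj1 (contr_point t fN)).
- move=> U oU; apply: sopen_prod_open => N c ch lc f t fc tI.
  have oW := sopen_contr (@sopen_weak N U oU).
  rewrite (contr_bound (low_point lc fc) (proj1 tI)) => /(oW c ch lc f t fc tI).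
  apply: near_imp => g s gc sI.
  by rewrite (contr_bound (low_point lc gc) (proj1 sI)).
- move=> f fp; have [N fN] := point_bounded fp.
  rewrite !(contr_bound fN); try lra.
  by rewrite contr_early ?contr_end //; lra.
Qed.

End Realization.

(** * Reduced words and the numbers game *)

Section Words.
Variables (S : finType) (E : rel S) (m : S -> S -> nat).
Hypothesis symE : forall s t, E s t = E t s.
Hypothesis irrE : forall s, ~~ E s s.
Hypothesis symm : forall s t, m s t = m t s.
Hypothesis m_ge2 : forall s t, E s t -> 2 <= m s t.

Local Notation "a ~~> b" := (artin_eq E m a b) (at level 70).

Lemma ae_refl a : a ~~> a.
Proof. exact: rst_refl. Qed.

Lemma ae_sym a b : a ~~> b -> b ~~> a.
Proof. exact: rst_sym. Qed.

Lemma ae_trans b a c : a ~~> b -> b ~~> c -> a ~~> c.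
Proof. exact: rst_trans. Qed.

Lemma ae_map (f : seq S -> seq S) :
  (forall a b, artin_step E m a b -> f a ~~> f b) ->
  forall a b, a ~~> b -> f a ~~> f b.
Proof.
move=> H a b; elim=> [x y /H //|x|x y _ /ae_sym //|x y z _ + _]; first exact: ae_refl.
exact: ae_trans.
Qed.

Lemma ae_catl u a b : a ~~> b -> u ++ a ~~> u ++ b.
Proof.
apply: (ae_map (f := cat u)) => _ _ [u' v s t Est]; apply: rst_step.
by rewrite !(catA u); apply: ArtinStep.
Qed.

Lemma ae_catr u a b : a ~~> b -> a ++ u ~~> b ++ u.
Proof.
apply: (ae_map (f := cat^~ u)) => _ _ [u' v s t Est]; apply: rst_step.
by rewrite -!catA; apply: ArtinStep.
Qed.

Lemma ae_cons s a b : a ~~> b -> s :: a ~~> s :: b.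
Proof. exact: (@ae_catl [:: s]). Qed.

Lemma size_alt (s t : S) k : size (alt s t k) = k.
Proof. by elim: k s t => //= k IH s t; rewrite IH. Qed.

Lemma ae_alt s t : E s t -> alt s t (m s t) ~~> alt t s (m s t).
Proof.
by move=> Est; apply: rst_step; move: (ArtinStep m [::] [::] Est); rewrite /= !cats0.
Qed.

Lemma ae_size a b : a ~~> b -> size a = size b.
Proof.
elim=> [_ _ [u v s t Est]|//|x y _ ->//|x y z _ -> _ //].
by rewrite !size_cat !size_alt.
Qed.

Lemma all_alt (P : pred S) s t k : 2 <= k -> all P (alt s t k) = P s && P t.
Proof.
have H j : all P (alt s t j) = ((0 < j) ==> P s) && ((1 < j) ==> P t).
  elim: j s t => [|j IH] s t //=; rewrite IH.
  by case: j {IH} => [|[|j]] /=; case: (P s); case: (P t).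
by move=> k2; rewrite H k2 (ltnW k2).
Qed.

Lemma ae_over T a b : a ~~> b -> word_over T a = word_over T b.
Proof.
elim=> [_ _ [u v s t Est]|//|x y _ ->//|x y z _ -> _ //].
by rewrite /word_over !all_cat !all_alt ?m_ge2 // (andbC (t \in T)).
Qed.

Lemma over_rcons (T : {set S}) a s :
  word_over T (rcons a s) = (s \in T) && word_over T a.
Proof. exact: all_rcons. Qed.

Lemma over_cat (T : {set S}) a b :
  word_over T (a ++ b) = word_over T a && word_over T b.
Proof. exact: all_cat. Qed.

Lemma alt_rcons (s t : S) k : alt s t k.+1 = rcons (alt s t k) (if odd k then t else s).
Proof.
elim: k s t => //= k IH s t.
by move: (IH t s) => /= ->; case: (odd k).
Qed.

Lemma rev_alt (s t : S) k : rev (alt s t k) = if odd k then alt s t k else alt t s k.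
Proof.
elim: k s t => // k IH s t; rewrite {1}alt_rcons rev_rcons IH /=.
by case: (odd k).
Qed.

Lemma artin_step_sym a b : artin_step E m a b -> artin_step E m b a.
Proof. by case=> u v s t Est; rewrite symm; apply: ArtinStep; rewrite symE. Qed.

Lemma ae_rev a b : a ~~> b -> rev a ~~> rev b.
Proof.
apply: ae_map => _ _ [u v s t Est]; rewrite !rev_cat -!catA; apply: rst_step.
rewrite !rev_alt; case: (odd _); first exact: ArtinStep.
by apply: artin_step_sym; apply: ArtinStep.
Qed.

Lemma ae_revE a b : rev a ~~> rev b -> a ~~> b.
Proof. by move=> /ae_rev; rewrite !revK. Qed.

(** Braid moves are reversible, so an equivalence becomes a chain that can be analysed from its last
    move. *)
Lemma ae_chain a b : a ~~> b -> clos_refl_trans_n1 _ (artin_step E m) a b.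
Proof.
move=> ab; apply: clos_rt_rtn1; elim: ab => [x y|x|x y _|x y z _ + _].
- exact: rt_step.
- exact: rt_refl.
- elim=> [u v /artin_step_sym|u|u v w _ + _]; [exact: rt_step|exact: rt_refl|].
  by move=> vu wv; apply: (rt_trans _ _ _ _ _ wv vu).
- exact: rt_trans.
Qed.

Local Open Scope R_scope.

(* The numbers game: the value at [s] of the state reached from the all-ones
   state by firing [w] is the value of a generic functional on the root
   [w(alpha_s)], so [asc] says that [w] is a reduced word. *)
Definition cf s t : R := if E s t then 2 * cos (PI / INR (m s t)) else 2.

(** The simple reflection acting on functionals given by their values on simple roots: [l] is
    composed with alpha_u -> alpha_u + cf s u alpha_s for u other than s. Pairs that are not edges
    have [cf] 2, the value for m infinite. *)
Definition fire s (l : S -> R) : S -> R :=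
  fun u => if u == s then - l s else l u + cf s u * l s.

Definition run (l : S -> R) (w : seq S) : S -> R :=
  foldl (fun l s => fire s l) l w.

Fixpoint asc (l : S -> R) (w : seq S) : Prop :=
  if w is s :: w' then 0 < l s /\ asc (fire s l) w' else True.

Lemma run_cat l u v : run l (u ++ v) = run (run l u) v.
Proof. by rewrite /run foldl_cat. Qed.

Lemma run_rcons l u s : run l (rcons u s) = fire s (run l u).
Proof. by rewrite -cats1 run_cat. Qed.

Lemma asc_cat l u v : asc l (u ++ v) <-> asc l u /\ asc (run l u) v.
Proof.
elim: u l => [|s u IH] l /=; first by split=> [|[]].
by rewrite IH; split=> [[? [? ?]]|[[? ?] ?]].
Qed.

Lemma asc_rcons l u s : asc l (rcons u s) <-> asc l u /\ 0 < run l u s.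
Proof. by rewrite -cats1 asc_cat /=; split=> [[? [? ?]]|[? ?]]. Qed.

Lemma fireK s : involutive (fire s).
Proof.
move=> l; apply: functional_extensionality => u; rewrite /fire eqxx.
by case: eqP => [->|_]; lra.
Qed.

(** * Rank two: the dihedral game *)

Lemma cf_sym s t : cf s t = cf t s.
Proof. by rewrite /cf symE symm. Qed.

(** Chebyshev polynomials of the second kind: at c = 2 cos th the value is sin (k th) / sin th, at c
    = 2 it is k. They give the coordinates of the roots of a dihedral system. *)
Fixpoint chebU (c : R) (k : nat) : R :=
  match k with
  | 0 => 0
  | k'.+1 => match k' with 0 => 1 | k''.+1 => c * chebU c k' - chebU c k'' end
  end.

Lemma chebUSS c k : chebU c k.+2 = c * chebU c k.+1 - chebU c k.
Proof. by []. Qed.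

Lemma chebU2 k : chebU 2 k = INR k.
Proof.
suff: chebU 2 k = INR k /\ chebU 2 k.+1 = INR k.+1 by case.
elim: k => [|k [IH1 IH2]]; first by split=> //=; lra.
by split=> //; rewrite chebUSS IH1 IH2 !S_INR; lra.
Qed.

Lemma chebU_sin th k : sin th * chebU (2 * cos th) k = sin (INR k * th).
Proof.
suff: sin th * chebU (2 * cos th) k = sin (INR k * th) /\
      sin th * chebU (2 * cos th) k.+1 = sin (INR k.+1 * th) by case.
elim: k => [|k [IH1 IH2]].
  by split=> /=; rewrite ?Rmult_0_l ?sin_0 ?Rmult_1_l; lra.
split=> //; rewrite chebUSS Rmult_minus_distr_l IH1.
have -> : sin th * (2 * cos th * chebU (2 * cos th) k.+1) =
   2 * cos th * (sin th * chebU (2 * cos th) k.+1) by ring.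
rewrite IH2; have -> : INR k.+2 * th = INR k.+1 * th + th by rewrite !S_INR; ring.
have -> : INR k * th = INR k.+1 * th - th by rewrite !S_INR; ring.
by rewrite sin_plus sin_minus; ring.
Qed.

Section Edge.
Variables s t : S.
Hypothesis Est : E s t.
Let th := PI / INR (m s t).

Lemma INR_m_ge2 : 2 <= INR (m s t).
Proof. by have /leP/le_INR := m_ge2 Est. Qed.

Lemma angleE : INR (m s t) * th = PI.
Proof. by rewrite /th; have := INR_m_ge2 => ?; field; lra. Qed.

Lemma angle_gt0 : 0 < th.
Proof.
have := INR_m_ge2 => ?; apply: Rdiv_lt_0_compat; first exact: PI_RGT_0.
lra.
Qed.

Lemma sin_angle_gt0 : 0 < sin th.
Proof.
have h2 := INR_m_ge2; have h0 := angle_gt0; have he := angleE.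
by apply: sin_gt_0 => //; nra.
Qed.

Lemma cf_edge : cf s t = 2 * cos th.
Proof. by rewrite /cf Est. Qed.

Lemma chebU_gt0 k : (0 < k < m s t)%N -> 0 < chebU (cf s t) k.
Proof.
case/andP=> /ltP/lt_INR k0 /ltP/lt_INR km; rewrite cf_edge.
apply: (Rmult_lt_reg_l (sin th)); first exact: sin_angle_gt0.
have h0 := angle_gt0; have he := angleE.
rewrite Rmult_0_r chebU_sin; apply: sin_gt_0.
  by apply: Rmult_lt_0_compat => //; move: k0 => /=; lra.
by nra.
Qed.

Lemma chebU_m : chebU (cf s t) (m s t) = 0.
Proof.
rewrite cf_edge; apply: (Rmult_eq_reg_l (sin th)); last by have := sin_angle_gt0; lra.
by rewrite chebU_sin angleE sin_PI; lra.
Qed.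

Lemma chebU_m1 : chebU (cf s t) (m s t).-1 = 1.
Proof.
rewrite cf_edge; apply: (Rmult_eq_reg_l (sin th)); last by have := sin_angle_gt0; lra.
rewrite chebU_sin.
have -> : INR (m s t).-1 * th = PI - th.
  by rewrite -angleE; case: (m s t) (m_ge2 Est) => // k _; rewrite S_INR /=; ring.
by rewrite sin_minus sin_PI cos_PI; lra.
Qed.

Lemma chebU_mS : chebU (cf s t) (m s t).+1 = -1.
Proof.
have := chebU_m1; have := chebU_m; have := m_ge2 Est.
by case: (m s t) => // k _ h0; rewrite -pred_Sn chebUSS h0 => ->; lra.
Qed.

Lemma cf_disc : 4 - cf s t * cf s t <> 0.
Proof.
have hs := sin_angle_gt0; have := sin2_cos2 th; rewrite /Rsqr cf_edge => h.
by nra.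
Qed.
End Edge.

(** The value fired at step [k], counted from 0, when [s] and [t] alternate starting from [x] at [s]
    and [y] at [t]. *)
Definition fval (c x y : R) k := chebU c k.+1 * x + chebU c k * y.

Lemma fvalS c x y k : fval c x y k.+1 = fval c (y + c * x) (- x) k.
Proof. by rewrite /fval chebUSS; ring. Qed.
Lemma asc_alt s t l k : s != t ->
  asc l (alt s t k) <-> forall j, (j < k)%N -> 0 < fval (cf s t) (l s) (l t) j.
Proof.
elim: k s t l => [|k IH] s t l neq //=.
have neq' : t != s by rewrite eq_sym.
rewrite IH // {1 2}/fire eqxx (negbTE neq') (cf_sym t s).
split=> [[h0 h] [|j] jk|h].
- by rewrite /fval /=; lra.
- by rewrite fvalS; apply: h.
- split=> [|j jk]; first by have := h 0%N isT; rewrite /fval /=; lra.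
  by rewrite -fvalS; apply: h.
Qed.

Lemma run_alt s t l k : s != t ->
  run l (alt s t k) (if odd k then t else s) = fval (cf s t) (l s) (l t) k /\
  run l (alt s t k) (if odd k then s else t) =
    (if k is k'.+1 then - fval (cf s t) (l s) (l t) k' else l t).
Proof.
elim: k s t l => [|k IH] s t l neq /=; first by rewrite /fval /=; split; ring.
have neq' : t != s by rewrite eq_sym.
have [] := IH t s (fire s l) neq'.
have -> : fire s l t = l t + cf s t * l s by rewrite /fire (negbTE neq').
have -> : fire s l s = - l s by rewrite /fire eqxx.
rewrite (cf_sym t s) -fvalS => h1 h2; move: h1 h2.
rewrite !(fun_if (run (fire s l) (alt t s k))).
case: (odd k) => /= -> ->; split=> //; case: (k) => [|j]; rewrite ?fvalS //;
  by rewrite /fval /=; ring.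
Qed.

Lemma edge_neq s t : E s t -> s != t.
Proof. by apply: contraTneq => ->. Qed.

(** [A] and [B] solve the linear system making alpha_u + A alpha_s + B alpha_t fixed by both
    reflections; its determinant 4 - c^2 is nonzero by [cf_disc]. *)
Lemma run_invariant s t u : E s t -> u != s -> u != t -> exists A B, forall w l,
  word_over [set s; t] w ->
  run l w u + A * run l w s + B * run l w t = l u + A * l s + B * l t.
Proof.
move=> Est us ut; have neq := edge_neq Est; have hd := cf_disc Est.
set c := cf s t in hd *; set p := cf s u; set q := cf t u.
exists ((2 * p + c * q) / (4 - c * c)), ((2 * q + c * p) / (4 - c * c)).
elim=> [|x w IH] l //= /andP[]; rewrite !inE => xst ws.
rewrite {}IH // /fire; case/orP: xst => /eqP->.
  by rewrite eqxx (negbTE us) (eq_sym t) (negbTE neq) -/c -/p; field.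
by rewrite eqxx (negbTE ut) (negbTE neq) (cf_sym t s) -/c -/q; field.
Qed.

(** The longest dihedral element acts as minus the identity, exchanging [s] and [t] when m is
    odd. *)
Lemma run_alt_m s t l : E s t ->
  run l (alt s t (m s t)) s = (if odd (m s t) then - l t else - l s) /\
  run l (alt s t (m s t)) t = (if odd (m s t) then - l s else - l t).
Proof.
move=> Est; have neq := edge_neq Est; have [] := run_alt l (m s t) neq.
have h0 := chebU_m Est; have h1 := chebU_m1 Est; have h2 := chebU_mS Est.
have -> : fval (cf s t) (l s) (l t) (m s t) = - l s by rewrite /fval h0 h2; lra.
have -> : (if m s t is k.+1 then - fval (cf s t) (l s) (l t) k else l t) = - l t.
  by case: (m s t) h0 h1 => [|k] h0 /= h1; [lra|rewrite /fval h0 h1; lra].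
by case: (odd _) => -> ->.
Qed.

Lemma alt_over (s t : S) k : word_over [set s; t] (alt s t k).
Proof.
suff H x y : x \in [set s; t] -> y \in [set s; t] -> word_over [set s; t] (alt x y k).
  by apply: H; rewrite !inE eqxx ?orbT.
by elim: k x y => //= k IH x y hx hy; rewrite hx IH.
Qed.

Lemma set2C (s t : S) : [set s; t] = [set t; s].
Proof. exact: setUC. Qed.

(** At [s] and [t] by [run_alt_m]; at any other letter the invariant transfers the equality. *)
Lemma run_braid s t l : E s t -> run l (alt s t (m s t)) = run l (alt t s (m s t)).
Proof.
move=> Est; apply: functional_extensionality => u.
have Ets : E t s by rewrite symE.
have [h1 h2] := run_alt_m l Est; have [] := run_alt_m l Ets.
rewrite (symm t s) => h3 h4.
case: (eqVneq u s) => [->|us]; first by rewrite h1 h4; case: (odd _).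
case: (eqVneq u t) => [->|ut]; first by rewrite h2 h3; case: (odd _).
have [A [B H]] := run_invariant Est us ut.
have := H (alt s t (m s t)) l (alt_over _ _ _).
have := H (alt t s (m s t)) l; rewrite {1}set2C => /(_ (alt_over _ _ _)).
by rewrite h1 h2 h3 h4; case: (odd _) => ? ?; lra.
Qed.

Lemma asc_alt_pos s t l k : s != t -> 0 < l s -> 0 < l t ->
  (E s t -> (k <= m s t)%N) -> asc l (alt s t k).
Proof.
move=> neq ls lt hk; rewrite asc_alt // => j jk; rewrite /fval.
case: (boolP (E s t)) => Est; last first.
  rewrite /cf (negbTE Est) !chebU2 S_INR; have := pos_INR j => ?; nra.
have jm : (j < m s t)%N by apply: leq_trans (hk Est).
have h1 : 0 <= chebU (cf s t) j.
  case: j {jk} jm => [|j] jm; first by rewrite /=; lra.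
  by apply: Rlt_le; apply: chebU_gt0.
have [jm'|jm'] := ltnP j.+1 (m s t).
  have h2 : 0 < chebU (cf s t) j.+1 by apply: chebU_gt0.
  nra.
(* At the last letter of the full word the coefficient of [l s] vanishes and that of [l t] is 1. *)
have jE : j.+1 = m s t by apply/eqP; rewrite eqn_leq jm.
have := chebU_m Est; have := chebU_m1 Est; rewrite -jE /= => -> e; rewrite e; lra.
Qed.

(** The first and last values fired are [l s] and [l t]. The criterion is symmetric in [s] and [t],
    so braid moves preserve ascending words. *)
Lemma asc_alt_m s t l : E s t -> asc l (alt s t (m s t)) <-> 0 < l s /\ 0 < l t.
Proof.
move=> Est; split=> [|[ls lt]]; last by apply: asc_alt_pos => //; exact: edge_neq.
rewrite asc_alt ?edge_neq // => H.
have m2 := m_ge2 Est; have m0 := ltnW m2.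
split; first by have := H 0%N m0; rewrite /fval /=; lra.
have := H (m s t).-1; rewrite ltn_predL => /(_ m0).
by rewrite /fval prednK // chebU_m // chebU_m1 //; lra.
Qed.

Lemma run_step a b l : artin_step E m a b -> run l a = run l b.
Proof. by case=> u v s t Est; rewrite !run_cat run_braid. Qed.

Lemma asc_step a b l : artin_step E m a b -> asc l a -> asc l b.
Proof.
case=> u v s t Est; have Ets : E t s by rewrite symE.
rewrite !asc_cat run_braid // => -[? [/(asc_alt_m _ Est) [? ?] ?]].
by split=> //; split=> //; rewrite symm; apply/asc_alt_m.
Qed.

Lemma ae_run a b l : a ~~> b -> run l a = run l b.
Proof. by elim=> [x y /run_step//|//|x y _ ->//|x y z _ -> _]. Qed.

Lemma ae_asc a b l : a ~~> b -> asc l a -> asc l b.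
Proof.
by move/ae_chain; elim=> // x y /asc_step h _ IH /IH /h.
Qed.

Lemma not_asc_square l u v s : ~ asc l (u ++ s :: s :: v).
Proof.
rewrite asc_cat /= => -[_ [h1 [+ _]]]; rewrite /fire eqxx; lra.
Qed.

Lemma asc_two_letters s t l d : s != t -> word_over [set s; t] d -> asc l d ->
  exists k, d = alt s t k \/ d = alt t s k.
Proof.
move=> neq; elim: d l => [|x d IH] l /=; first by exists 0%N; left.
move=> /andP[xst dst] [lx /[dup] ad /(IH _ dst) [k dk]].
have nx y k' : d = alt x y k' -> k' = 0%N.
  by case: k' => // k' de; move: ad; rewrite de /= /fire eqxx => -[]; lra.
have H y k' : d = alt x y k' -> exists k, x :: d = alt x y k.
  by move=> de; exists 1%N; rewrite de (nx _ _ de).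
move: xst; rewrite !inE => /orP[] /eqP xE; subst x; case: dk => dk.
- by have [k' ->] := H _ _ dk; exists k'; left.
- by exists k.+1; left; rewrite dk.
- by exists k.+1; right; rewrite dk.
- by have [k' ->] := H _ _ dk; exists k'; right.
Qed.

Lemma asc_alt_le s t l k : E s t -> 0 < l s -> asc l (alt s t k) -> (k <= m s t)%N.
Proof.
move=> Est ls; rewrite asc_alt ?edge_neq // leqNgt => H; apply/negP => /H.
by rewrite /fval chebU_m // chebU_mS //; lra.
Qed.

(** At length m the braid relation lets the word end in either letter. Otherwise the word can still
    be extended by the letter it does not end in, so at most its last letter is a descent. *)
Lemma dihedral_exchange s t l k u : s != t -> 0 < l s -> 0 < l t ->
  asc l (alt s t k) -> u \in [set s; t] ->
  run l (alt s t k) u <> 0 /\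
  (run l (alt s t k) u < 0 ->
    exists d, word_over [set s; t] d /\ alt s t k ~~> rcons d u).
Proof.
move=> neq ls lt ad ust.
have [/andP[Est /eqP ->]|/nandP hk] := boolP (E s t && (k == m s t)).
  have [h1 h2] := run_alt_m l Est; have m2 := m_ge2 Est.
  split.
    by move: ust; rewrite !inE => /orP[] /eqP->; rewrite ?h1 ?h2; case: (odd _); lra.
  move=> _; set k' := (m s t).-1.
  have mE : m s t = k'.+1 by rewrite prednK // ltnW.
  have over x y : x \in [set s; t] -> y \in [set s; t] ->
      word_over [set s; t] (alt x y k').
    move=> hx hy; have := alt_over x y k'; apply: sub_all => z.
    by rewrite !inE => /orP[] /eqP ->; rewrite -in_set2.
  have [-> | ->] : u = (if odd k' then t else s) \/ u = (if odd k' then s else t).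
  + by move: ust; rewrite !inE => /orP[] /eqP->; case: (odd _); [right|left|left|right].
  + exists (alt s t k'); rewrite -alt_rcons -mE; split; last exact: ae_refl.
    by apply: over; rewrite !inE eqxx ?orbT.
  + exists (alt t s k'); rewrite -alt_rcons -mE; split; last exact: ae_alt.
    by apply: over; rewrite !inE eqxx ?orbT.
have hk' : E s t -> (k < m s t)%N.
  move=> Est; rewrite ltn_neqAle (asc_alt_le _ _ ad) // andbT.
  by case: hk => //; rewrite Est.
have [h1 h2] := run_alt l k neq.
have p1 : 0 < fval (cf s t) (l s) (l t) k.
  have : asc l (alt s t k.+1) by apply: asc_alt_pos.
  by rewrite asc_alt //; apply.
have [uE | uE] : u = (if odd k then t else s) \/ u = (if odd k then s else t).
- by move: ust; rewrite !inE => /orP[] /eqP->; case: (odd _); [right|left|left|right].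
- by rewrite uE h1; split; lra.
rewrite uE h2; case: k ad {hk hk' h1 h2 p1} uE => [|k] ad uE; first by split; lra.
have p2 : 0 < fval (cf s t) (l s) (l t) k by move: ad; rewrite asc_alt //; apply.
split; first by lra.
move=> _; exists (alt s t k); split; first exact: alt_over.
by rewrite [X in X ~~> _]alt_rcons /=; case: (odd k); exact: ae_refl.
Qed.

Lemma dihedral_descents s t l k : s != t -> 0 < l s -> 0 < l t ->
  asc l (alt s t k) -> run l (alt s t k) s < 0 -> run l (alt s t k) t < 0 ->
  E s t /\ k = m s t.
Proof.
move=> neq ls lt ad rs rt.
have [h1 _] := run_alt l k neq.
have f0 : fval (cf s t) (l s) (l t) k < 0 by rewrite -h1; case: (odd k).
have [/andP[Est /eqP //]|/nandP hk] := boolP (E s t && (k == m s t)).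
have : asc l (alt s t k.+1).
  apply: asc_alt_pos => // Est; rewrite ltn_neqAle (asc_alt_le _ _ ad) // andbT.
  by case: hk => //; rewrite Est.
by rewrite asc_alt // => /(_ k (ltnSn k)); lra.
Qed.

(** * The exchange condition *)

Section Game.
(** Two instances matter: all letters with the all-ones state, for reduced words, and a subset with
    the negated state of a reduced word, for finiteness of W_T. *)
Variables (T : {set S}) (l0 : S -> R).
Hypothesis l0_gt0 : forall s, s \in T -> 0 < l0 s.

Definition exchange_at (a : seq S) := forall t, t \in T ->
  run l0 a t <> 0 /\
  (run l0 a t < 0 -> exists a', [/\ word_over T a', asc l0 a' & a ~~> rcons a' t]).

Lemma word_over_sub (A B : {set S}) w : A \subset B -> word_over A w -> word_over B w.
Proof. by move/subsetP=> AB; apply: sub_all. Qed.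

Lemma set2_sub (s t : S) : s \in T -> t \in T -> [set s; t] \subset T.
Proof. by move=> sT tT; apply/subsetP => x; rewrite !inE => /orP[]/eqP->. Qed.

(** Descents [s] and [t] are stripped from the right until none is left. Exchange is assumed up to
    length [n] because its own proof uses this splitting. *)
Lemma dihedral_split n a s t :
  (forall b, word_over T b -> asc l0 b -> (size b <= n)%N -> exchange_at b) ->
  s \in T -> t \in T -> word_over T a -> asc l0 a -> (size a <= n)%N ->
  exists b d, [/\ word_over T b, word_over [set s; t] d, a ~~> b ++ d,
    0 < run l0 b s & 0 < run l0 b t].
Proof.
move=> exch sT tT; elim/ltn_ind: {a}(size a) {-2}a (erefl (size a)) => k IH a sa aT asca an.
have down u : u \in [set s; t] -> run l0 a u < 0 ->
  exists b d, [/\ word_over T b, word_over [set s; t] d, a ~~> b ++ d,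
    0 < run l0 b s & 0 < run l0 b t].
  move=> ust au; have uT : u \in T by move: u ust {au}; apply/subsetP; exact: set2_sub.
  have [_ /(_ au) [a' [aT' asca' aa']]] := exch _ aT asca an u uT.
  have sz := ae_size aa'; rewrite size_rcons in sz.
  have lt' : (size a' < k)%N by rewrite -sa sz.
  have [|b [d [bT dst a'b hs ht]]] := IH _ lt' _ (erefl _) aT' asca'.
    by apply: leq_trans an; rewrite sz.
  exists b, (rcons d u); split=> //.
    by rewrite over_rcons ust.
  by apply: (ae_trans aa'); rewrite -!cats1 catA; apply: ae_catr.
have [ns _] := exch _ aT asca an s sT; have [nt _] := exch _ aT asca an t tT.
case: (Rlt_le_dec (run l0 a s) 0) => hs; first by apply: down hs; rewrite !inE eqxx.
case: (Rlt_le_dec (run l0 a t) 0) => ht; first by apply: down ht; rewrite !inE eqxx orbT.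
by exists a, [::]; rewrite cats0; split=> //; [exact: ae_refl|lra|lra].
Qed.

Lemma asc_sub_alt s t b d l : s != t -> 0 < run l b s -> 0 < run l b t ->
  word_over [set s; t] d -> asc l (b ++ d) ->
  exists x y k, [/\ d = alt x y k, x != y, [set x; y] = [set s; t],
    0 < run l b x /\ 0 < run l b y & asc (run l b) (alt x y k)].
Proof.
move=> neq hs ht dst; rewrite asc_cat => -[_ ad].
have [k [dE|dE]] := asc_two_letters neq dst ad.
  by exists s, t, k; rewrite -dE.
by exists t, s, k; rewrite -dE eq_sym set2C.
Qed.

(** Induction on length. If the last letter s differs from t, the word before it splits as b d with
    d in the letters s and t, and the claim becomes the dihedral one for d s over the state of b. *)
Lemma exchangeP a : word_over T a -> asc l0 a -> exchange_at a.
Proof.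
elim/ltn_ind: {a}(size a) {-2}a (erefl (size a)) => k IH a sa aT asca t tT.
case: (lastP a) => [|a1 s] in sa aT asca *.
  by rewrite /=; have := l0_gt0 tT; split; lra.
have [asca1 a1s] := (iffLR (asc_rcons _ _ _) asca).
have /andP[sT a1T] : (s \in T) && word_over T a1 by rewrite -over_rcons.
case: (eqVneq s t) => [st|neq].
  subst t; rewrite run_rcons /fire eqxx; split; first by lra.
  by move=> _; exists a1; split=> //; exact: ae_refl.
rewrite size_rcons in sa.
have [||b [d [bT dst a1E hs ht]]] := dihedral_split (n := size a1) _ sT tT a1T asca1.
- by move=> b bT ascb bn; apply: (IH (size b)) => //; rewrite -sa.
- by [].
have aE : rcons a1 s ~~> b ++ rcons d s.
  by rewrite -!cats1 catA; exact: ae_catr.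
have dst' : word_over [set s; t] (rcons d s) by rewrite over_rcons !inE eqxx.
have ascb := ae_asc aE asca.
have [x [y [j [dE nxy xyE [hx hy] ad]]]] := asc_sub_alt neq hs ht dst' ascb.
rewrite (ae_run _ aE) dE run_cat.
have tst : t \in [set x; y] by rewrite xyE !inE eqxx orbT.
have [h1 h2] := dihedral_exchange nxy hx hy ad tst.
split=> // /h2 [d' [d'xy dd']]; exists (b ++ d').
have aE' : rcons a1 s ~~> rcons (b ++ d') t.
  by apply: (ae_trans aE); rewrite dE rcons_cat; exact: ae_catl.
split=> //.
  rewrite over_cat; apply/andP; split=> //.
  by apply: word_over_sub d'xy; rewrite xyE; exact: set2_sub.
by have := ae_asc aE' asca; rewrite asc_rcons => -[].
Qed.

Lemma exchange a t : t \in T -> word_over T a -> asc l0 a -> run l0 a t < 0 ->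
  exists a', [/\ word_over T a', asc l0 a' & a ~~> rcons a' t].
Proof. by move=> tT aT asca; have [_] := exchangeP aT asca tT. Qed.

Lemma run_neq0 a t : t \in T -> word_over T a -> asc l0 a -> run l0 a t <> 0.
Proof. by move=> tT aT asca; have [] := exchangeP aT asca tT. Qed.

(** In the splitting of [a], two descents force the dihedral tail to have full length m. *)
Lemma descents2 a s t : s != t -> s \in T -> t \in T -> word_over T a -> asc l0 a ->
  run l0 a s < 0 -> run l0 a t < 0 ->
  E s t /\ exists b, a ~~> b ++ alt s t (m s t).
Proof.
move=> neq sT tT aT asca rs rt.
have [||b [d [bT dst aE hs ht]]] := dihedral_split (n := size a) _ sT tT aT asca.
- by move=> b bT ascb _; exact: exchangeP.
- by [].
have ascb := ae_asc aE asca.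
have [x [y [j [dE nxy xyE [hx hy] ad]]]] := asc_sub_alt neq hs ht dst ascb.
move: rs rt; rewrite (ae_run _ aE) dE run_cat => rs rt.
have hxy z : z \in [set x; y] -> run (run l0 b) (alt x y j) z < 0.
  by rewrite xyE !inE => /orP[]/eqP->.
have [Exy jE] := dihedral_descents nxy hx hy ad (hxy _ (set21 _ _)) (hxy _ (set22 _ _)).
have Est : (x = s /\ y = t) \/ (x = t /\ y = s).
  have: x \in [set s; t] by rewrite -xyE set21.
  have: y \in [set s; t] by rewrite -xyE set22.
  rewrite !inE => /orP[]/eqP ye /orP[]/eqP xe; subst; rewrite ?eqxx // in nxy *; tauto.
case: Est => -[xe ye]; subst x y j.
  by split=> //; exists b; rewrite -dE.
have Ets : E s t by rewrite symE.
split=> //; exists b; apply: (ae_trans aE); rewrite dE symm; apply: ae_catl.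
by apply/ae_sym; exact: ae_alt.
Qed.

(** Faithfulness of the game, in the spirit of Matsumoto: the last letter of [a] is a descent of the
    common state, so exchange makes [b] end in it too. *)
Lemma reduced_inj a b : word_over T a -> word_over T b -> asc l0 a -> asc l0 b ->
  run l0 a = run l0 b -> a ~~> b.
Proof.
elim/last_ind: a b => [|a s IH] b aT bT asca ascb e.
  case: (lastP b) bT ascb e => [*|b' s]; first exact: ae_refl.
  rewrite over_rcons asc_rcons run_rcons => /andP[sT _] [_ hs] e.
  have := l0_gt0 sT; have -> : l0 s = fire s (run l0 b') s by rewrite -e.
  rewrite /fire eqxx; lra.
have /andP[sT a1T] : (s \in T) && word_over T a by rewrite -over_rcons.
have [asca1 a1s] := (iffLR (asc_rcons _ _ _) asca).
have [|b' [b'T ascb' bE]] := exchange sT bT ascb.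
  by rewrite -e run_rcons /fire eqxx; lra.
apply: ae_trans (ae_sym bE); rewrite -!cats1; apply: ae_catr; apply: IH => //.
by apply: (can_inj (fireK s)); rewrite -!run_rcons e (ae_run _ bE).
Qed.

End Game.

(** * Reduced words *)

Definition ones : S -> R := fun=> 1.
Definition reduced w := asc ones w.

Lemma ones_gt0 s : s \in [set: S] -> 0 < ones s.
Proof. by rewrite /ones; lra. Qed.

Lemma overT w : word_over [set: S] w.
Proof. by apply/allP => x _; rewrite inE. Qed.

Lemma reduced_prefix u v : reduced (u ++ v) -> reduced u.
Proof. by rewrite /reduced asc_cat => -[]. Qed.

(** Exchange produces the square at the first letter that does not ascend. Squares up to braid moves
    do not depend on the reading direction, which yields [reduced_rev]. *)
Lemma reduced_or_square w : reduced w \/ exists u s v, w ~~> u ++ s :: s :: v.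
Proof.
elim/last_ind: w => [|w s [IH|[u [t [v H]]]]]; first by left.
  case: (Rlt_le_dec 0 (run ones w s)) => hs; first by left; apply/asc_rcons.
  right; have n0 := run_neq0 ones_gt0 (in_setT s) (overT w) IH.
  have [|w' [_ _ wE]] := exchange ones_gt0 (in_setT s) (overT w) IH; first by lra.
  exists w', s, [::]; rewrite -!cats1; apply: (ae_trans (ae_catr _ wE)).
  by rewrite -cats1 -catA; exact: ae_refl.
right; exists u, t, (rcons v s); rewrite -!cats1.
by apply: (ae_trans (ae_catr _ H)); rewrite -catA; exact: ae_refl.
Qed.

Lemma reduced_rev w : reduced w -> reduced (rev w).
Proof.
move=> rw; case: (reduced_or_square (rev w)) => // -[u [s [v H]]].
have := ae_rev H; rewrite revK => /ae_asc /(_ rw).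
by rewrite rev_cat !rev_cons -!cats1 -!catA /= => /not_asc_square.
Qed.

Lemma reduced_suffix u v : reduced (u ++ v) -> reduced v.
Proof.
by move/reduced_rev; rewrite rev_cat => /reduced_prefix/reduced_rev; rewrite revK.
Qed.

Lemma reduced_alt w s t : E s t -> reduced (rcons w s) -> reduced (rcons w t) ->
  reduced (w ++ alt s t (m s t)).
Proof.
move=> Est /asc_rcons [rw ws] /asc_rcons [_ wt].
by apply/asc_cat; split=> //; exact/asc_alt_m.
Qed.

Lemma run_descent w s : run ones (rcons w s) s < 0 <-> 0 < run ones w s.
Proof. by rewrite run_rcons /fire eqxx; split; lra. Qed.

Lemma reduced_left_descents a s t X Y : s != t -> reduced a ->
  a ~~> s :: X -> a ~~> t :: Y ->
  E s t /\ exists P, a ~~> alt s t (m s t) ++ P.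
Proof.
move=> neq /reduced_rev ra aX aY.
have des u Z : a ~~> u :: Z -> run ones (rev a) u < 0.
  move=> /ae_rev; rewrite rev_cons => aZ.
  by rewrite (ae_run _ aZ) run_descent; have /asc_rcons [] := ae_asc aZ ra.
have [Est [b bE]] := descents2 ones_gt0 neq (in_setT s) (in_setT t) (overT _) ra
  (des _ _ aX) (des _ _ aY).
split=> //; exists (rev b); have := ae_rev bE; rewrite revK rev_cat rev_alt.
case: (odd _) => // aE; apply: (ae_trans aE); apply: ae_catr.
by apply/ae_sym; exact: ae_alt.
Qed.

(** After reversal the common letter is last and can be unfired, and [reduced_inj] compares the
    states. Cancellation among reduced words thus precedes cancellation in the monoid. *)
Lemma reduced_cancel u a b : reduced (u ++ a) -> u ++ a ~~> u ++ b -> a ~~> b.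
Proof.
elim: u => //= s u IH rsa sab; apply: IH; first by have := @reduced_suffix [:: s] _ rsa.
have ra := reduced_rev rsa; have rE := ae_rev sab.
have rb := ae_asc rE ra.
apply: ae_revE; move: ra rb rE; rewrite !rev_cons => /asc_rcons [ra _] /asc_rcons [rb _] rE.
apply: (reduced_inj ones_gt0) => //; try exact: overT.
by apply: (can_inj (fireK s)); rewrite -!run_rcons (ae_run _ rE).
Qed.

(** * The reduction lemma *)

(** Garside's lemma below a length bound: joins and cancellation are derived from one bound and used
    to prove the next. *)
Definition reduction_at (n : nat) := forall s t X Y, (size X < n)%N ->
  s :: X ~~> t :: Y ->
  (s = t /\ X ~~> Y) \/
  (E s t /\ exists V, X ~~> alt t s (m s t).-1 ++ V /\ Y ~~> alt s t (m s t).-1 ++ V).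

Lemma alt_m s t : E s t -> alt s t (m s t) = s :: alt t s (m s t).-1.
Proof. by move=> /m_ge2; case: (m s t). Qed.

Lemma cancel_of_reduction n : reduction_at n ->
  forall u a b, (size (u ++ a) <= n)%N -> u ++ a ~~> u ++ b -> a ~~> b.
Proof.
move=> red; elim=> //= s u IH a b sz /(red s s _ _ sz) [[_ sab]|[]].
  by apply: IH sab; exact: ltnW.
by rewrite (negbTE (irrE s)).
Qed.

(* The local form of the existence of joins among reduced elements. *)
Lemma reduced_join n : reduction_at n -> forall U w0 x y x' y', (size U <= n)%N ->
  U ~~> x ++ y -> U ~~> x' ++ y' -> reduced (w0 ++ x) -> reduced (w0 ++ x') ->
  exists v z, [/\ U ~~> v ++ z, reduced (w0 ++ v),
    exists p, v ~~> x ++ p & exists p', v ~~> x' ++ p'].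
Proof.
move=> red U; elim/ltn_ind: {U}(size U) {-2}U (erefl (size U)) => k IH U Uk.
move=> w0 [|s x] y x' y' kn Ux Ux' rx rx'.
  exists x', y'; split=> //; first by exists x'; exact: ae_refl.
  by exists [::]; rewrite cats0; exact: ae_refl.
case: x' Ux' rx' => [|t x'] Ux' rx'.
  exists (s :: x), y; split=> //; last by exists (s :: x); exact: ae_refl.
  by exists [::]; rewrite cats0; exact: ae_refl.
rewrite Uk in kn; have ss' := ae_trans (ae_sym Ux) Ux'; have sz := ae_size Ux; have sz' := ae_size Ux'.
rewrite /= in sz sz'.
have sz1 : (size (x ++ y) < k)%N by rewrite -Uk sz.
have sz1' : (size (x' ++ y') < k)%N by rewrite -Uk sz'.
have rcat a b c : reduced (a ++ b :: c) -> reduced ((a ++ [:: b]) ++ c).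
  by rewrite -catA.
case: (red _ _ _ _ (leq_trans sz1 kn) ss') => [[st xx]|[Est [Z [xZ x'Z]]]].
  subst t; have [v [z [Uv rv [p vx] [p' vx']]]] :=
    IH _ sz1 (x ++ y) erefl (w0 ++ [:: s]) x y x' y' (ltnW (leq_trans sz1 kn))
      (ae_refl _) xx (rcat _ _ _ rx) (rcat _ _ _ rx').
  exists (s :: v), z; split.
  - by apply: (ae_trans Ux); exact: ae_cons.
  - by move: rv; rewrite -catA.
  - by exists p; exact: ae_cons.
  - by exists p'; exact: ae_cons.
have Ets : E t s by rewrite symE.
have [ws wt] : reduced (rcons w0 s) /\ reduced (rcons w0 t).
  by rewrite -!cats1; split; [apply: (@reduced_prefix _ x)|apply: (@reduced_prefix _ x')];
    rewrite -catA.
have rA : reduced (w0 ++ alt s t (m s t)) by exact: reduced_alt.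
have rB : reduced (w0 ++ alt t s (m s t)) by rewrite symm; exact: reduced_alt.
have aA := alt_m Est; have aB := alt_m Ets; rewrite (symm t s) in aB.
set A := alt t s (m s t).-1 in aA xZ *; set B := alt s t (m s t).-1 in aB x'Z *.
rewrite aA in rA; rewrite aB in rB.
(* [x] is joined with the rest of the relator after [s], then [x'] with the rest after [t]. Preceded
   by [s] and [t], both joins are multiples of the relator; a third join, of the quotients [q1] and
   [q2], merges them. *)
have [v1 [z1 [Uv1 rv1 [p1 v1x] [q1 v1A]]]] :=
  IH _ sz1 (x ++ y) erefl (w0 ++ [:: s]) x y A Z (ltnW (leq_trans sz1 kn)) (ae_refl _) xZ
    (rcat _ _ _ rx) (rcat _ _ _ rA).
have [v2 [z2 [Uv2 rv2 [p2 v2x] [q2 v2B]]]] :=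
  IH _ sz1' (x' ++ y') erefl (w0 ++ [:: t]) x' y' B Z (ltnW (leq_trans sz1' kn)) (ae_refl _) x'Z
    (rcat _ _ _ rx') (rcat _ _ _ rB).
have UA : U ~~> alt s t (m s t) ++ (q1 ++ z1).
  rewrite aA /= catA; apply: (ae_trans Ux); apply: ae_cons; apply: (ae_trans Uv1).
  exact: ae_catr.
have UB : U ~~> alt s t (m s t) ++ (q2 ++ z2).
  apply: (@ae_trans (alt t s (m s t) ++ (q2 ++ z2))).
    rewrite aB /= catA; apply: (ae_trans Ux'); apply: ae_cons; apply: (ae_trans Uv2).
    exact: ae_catr.
  by apply: ae_catr; rewrite symm; exact: ae_alt.
have qq : q1 ++ z1 ~~> q2 ++ z2.
  apply: (cancel_of_reduction red (u := alt s t (m s t))); last exact: ae_trans (ae_sym UA) UB.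
  by rewrite -(ae_size UA) Uk.
have szq : (size (q1 ++ z1) < k)%N.
  by rewrite -Uk (ae_size UA) [ltnRHS]size_cat size_alt -[ltnLHS]add0n ltn_add2r ltnW ?m_ge2.
have [||v3 [z3 [Uv3 rv3 [p3 v3q] [p3' v3q']]]] :=
  IH _ szq (q1 ++ z1) erefl (w0 ++ alt s t (m s t)) q1 z1 q2 z2
    (ltnW (leq_trans szq kn)) (ae_refl _) qq.
- apply: ae_asc rv1; rewrite -!catA; apply: ae_catl; rewrite aA /=; exact: ae_cons.
- apply: ae_asc rv2; rewrite -!catA; apply: ae_catl.
  apply: (@ae_trans (alt t s (m s t) ++ q2)); first by rewrite aB /=; exact: ae_cons.
  by apply: ae_catr; rewrite symm; exact: ae_alt.
exists (alt s t (m s t) ++ v3), z3; split.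
- by apply: (ae_trans UA); rewrite -catA; exact: ae_catl.
- by rewrite catA.
- exists (p1 ++ p3); rewrite catA /=; apply: (@ae_trans (alt s t (m s t) ++ q1 ++ p3)).
    exact: ae_catl.
  rewrite aA /=; apply: ae_cons; rewrite catA; apply: ae_catr.
  exact: ae_trans (ae_sym v1A) v1x.
- exists (p2 ++ p3'); rewrite catA /=; apply: (@ae_trans (alt s t (m s t) ++ q2 ++ p3')).
    exact: ae_catl.
  apply: (@ae_trans (alt t s (m s t) ++ q2 ++ p3')).
    by apply: ae_catr; exact: ae_alt.
  rewrite aB /=; apply: ae_cons; rewrite catA; apply: ae_catr.
  exact: ae_trans (ae_sym v2B) v2x.
Qed.

Lemma artin_step_cons u Z t Y : artin_step E m (u :: Z) (t :: Y) ->
  (u = t /\ Z ~~> Y) \/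
  (E u t /\ exists Q, Z = alt t u (m u t).-1 ++ Q /\ Y = alt u t (m u t).-1 ++ Q).
Proof.
move eA : (u :: Z) => A; move eB : (t :: Y) => B H.
case: H eA eB => -[|c w] v x y Exy.
  have Eyx : E y x by rewrite symE.
  rewrite /= alt_m // symm alt_m //= => -[-> ->] [-> ->]; right; split=> //.
  by exists v; rewrite (symm x y).
by move=> [-> ->] [-> ->]; left; split=> //; apply: rst_step; exact: ArtinStep.
Qed.

Lemma reduced_alt0 s t : E s t -> reduced (alt s t (m s t)).
Proof. by move=> Est; apply: (@reduced_alt [::]) => //=; rewrite /reduced /= /ones; lra. Qed.

(* If [sX ~ uZ ~ tY] with both equalities given by a braid relation, a reduced
   common multiple of the two relators shows that [s] and [t] are descents of
   one reduced word, hence that they braid. *)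
Lemma reduction_triangle n s t u X Y Z V Q : reduction_at n -> (size Z <= n)%N -> s != t ->
  E s u -> E u t ->
  X ~~> alt u s (m s u).-1 ++ V -> Z ~~> alt s u (m s u).-1 ++ V ->
  Z ~~> alt t u (m u t).-1 ++ Q -> Y ~~> alt u t (m u t).-1 ++ Q ->
  E s t /\ exists V, X ~~> alt t s (m s t).-1 ++ V /\ Y ~~> alt s t (m s t).-1 ++ V.
Proof.
move=> red szZ neq Esu Eut XV ZV ZQ YQ; have IHc := cancel_of_reduction red.
have Eus : E u s by rewrite symE.
have Etu : E t u by rewrite symE.
have [||v [z [Zv ruv [p vp] [p' vp']]]] := reduced_join (w0 := [:: u]) red szZ ZV ZQ.
- by rewrite /= (symm s u) -alt_m //; exact: reduced_alt0.
- by rewrite /= -alt_m //; exact: reduced_alt0.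
rewrite /= in ruv.
have uvs : u :: v ~~> s :: (alt u s (m s u).-1 ++ p).
  apply: (ae_trans (ae_cons u vp)); rewrite -!cat_cons (symm s u) -alt_m // (symm u s) -alt_m //.
  by apply: ae_catr; rewrite symm; exact: ae_alt.
have uvt : u :: v ~~> t :: (alt u t (m u t).-1 ++ p').
  apply: (ae_trans (ae_cons u vp')); rewrite -!cat_cons -alt_m // (symm u t) -alt_m //.
  by apply: ae_catr; rewrite symm; exact: ae_alt.
have [Est [P uvP]] := reduced_left_descents neq ruv uvs uvt.
have Ets : E t s by rewrite symE.
have sP : alt u s (m s u).-1 ++ p ~~> alt t s (m s t).-1 ++ P.
  apply: (@reduced_cancel [:: s]); first exact: ae_asc ruv.
  by apply: (ae_trans (ae_sym uvs)); rewrite /= -cat_cons -alt_m.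
have tP : alt u t (m u t).-1 ++ p' ~~> alt s t (m s t).-1 ++ P.
  apply: (@reduced_cancel [:: t]); first exact: ae_asc ruv.
  apply: (ae_trans (ae_sym uvt)); apply: (ae_trans uvP).
  by rewrite /= -cat_cons (symm s t) -alt_m //; apply: ae_catr; rewrite symm; exact: ae_alt.
have Vpz : V ~~> p ++ z.
  apply: (IHc (alt s u (m s u).-1)); first by rewrite -(ae_size ZV).
  apply: (ae_trans (ae_sym ZV)); apply: (ae_trans Zv); rewrite catA; exact: ae_catr.
have Qpz : Q ~~> p' ++ z.
  apply: (IHc (alt t u (m u t).-1)); first by rewrite -(ae_size ZQ).
  apply: (ae_trans (ae_sym ZQ)); apply: (ae_trans Zv); rewrite catA; exact: ae_catr.
split=> //; exists (P ++ z); split.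
  apply: (ae_trans XV); apply: (ae_trans (ae_catl _ Vpz)); rewrite !catA; exact: ae_catr.
apply: (ae_trans YQ); apply: (ae_trans (ae_catl _ Qpz)); rewrite !catA; exact: ae_catr.
Qed.

(** Induction on [n] and, inside, on the chain of braid moves. The earlier moves count as one change
    of first letter from s to u, the last one leads from u to t: if t = s, cancellation at smaller
    length concludes, otherwise [reduction_triangle]. *)
Lemma reductionP n : reduction_at n.
Proof.
elim: n => [//|n IHn] s t X Y szX sXtY; rewrite ltnS in szX.
have IHc := cancel_of_reduction IHn.
move ew : (t :: Y) (ae_chain sXtY) => w c; elim: c t Y ew {sXtY}.
  by move=> t Y [-> ->]; left; split=> //; exact: ae_refl.
move=> y w' yw' cy IH t Y ew'; subst w'.
case: y => [|u Z] in yw' cy IH *; first by have := ae_size (rst_step _ _ _ _ yw').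
have {}IH := IH _ _ erefl.
case: (artin_step_cons yw') => [[ut ZY]|[Eut [Q [ZE YE]]]].
  subst u; case: IH => [[st XZ]|[Est [V [XV ZV]]]].
    by left; split=> //; exact: ae_trans XZ ZY.
  by right; split=> //; exists V; split=> //; exact: ae_trans (ae_sym ZY) ZV.
have ZQ : Z ~~> alt t u (m u t).-1 ++ Q by rewrite ZE; exact: ae_refl.
have YQ : Y ~~> alt u t (m u t).-1 ++ Q by rewrite YE; exact: ae_refl.
case: IH => [[su XZ]|[Esu [V [XV ZV]]]].
  subst u; right; split=> //; exists Q; split=> //; exact: ae_trans XZ ZQ.
have szZ : (size Z <= n)%N.
  by apply: leq_trans szX; rewrite (ae_size XV) (ae_size ZV) !size_cat !size_alt.
case: (eqVneq s t) => [st|neq].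
  subst t; left; split=> //; apply: (ae_trans XV); rewrite YE (symm u s); apply: ae_catl.
  apply: (IHc (alt s u (m s u).-1)); first by rewrite -(ae_size ZV).
  by apply: (ae_trans (ae_sym ZV)); rewrite (symm s u).
by right; apply: (reduction_triangle IHn szZ neq Esu Eut XV ZV ZQ YQ).
Qed.

Lemma cancel_left u a b : u ++ a ~~> u ++ b -> a ~~> b.
Proof. exact: cancel_of_reduction (@reductionP _) _ _ _ (leqnn _). Qed.

Lemma reduction_right s t X Y : rcons X s ~~> rcons Y t ->
  (s = t /\ X ~~> Y) \/
  exists V d d', [/\ X ~~> V ++ d, Y ~~> V ++ d',
    word_over [set s; t] d & word_over [set s; t] d'].
Proof.
move=> /ae_rev; rewrite !rev_rcons => H.
case: (reductionP (ltnSn _) H) => [[-> /ae_revE XY]|[Est [V [/ae_rev XV /ae_rev YV]]]].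
  by left.
right; move: XV YV; rewrite !revK !rev_cat => XV YV.
exists (rev V), (rev (alt t s (m s t).-1)), (rev (alt s t (m s t).-1)).
by split=> //; rewrite /word_over all_rev; [rewrite set2C|]; exact: alt_over.
Qed.

(** * Right divisors and finiteness of Coxeter groups *)

Definition rdiv s a := exists a', a ~~> rcons a' s.

(** The letters are joined one at a time to a reduced left divisor of [a], by [reduced_join] with
    empty prefix. *)
Lemma reduced_left_multiple (l : seq S) a : (forall s, s \in l -> exists X, a ~~> s :: X) ->
  exists v z, [/\ a ~~> v ++ z, reduced v & forall s, s \in l -> exists X, v ~~> s :: X].
Proof.
elim: l => [|s l IH] H; first by exists [::], a; split=> //; exact: ae_refl.
have [|v [z [av rv Hv]]] := IH; first by move=> t tl; apply: H; rewrite inE tl orbT.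
have [|X aX] := H s; first by rewrite inE eqxx.
have [|v' [z' [av' rv' [p vp] [p' vp']]]] :=
  reduced_join (w0 := [::]) (@reductionP _) (leqnn _) av (aX : a ~~> [:: s] ++ X) rv.
  by rewrite /reduced /= /ones; lra.
exists v', z'; split=> // t; rewrite inE => /orP[/eqP->|/Hv [Y vY]]; first by exists p'.
by exists (Y ++ p); apply: (ae_trans vp); exact: (ae_catr p vY).
Qed.

Lemma reduced_right_multiple (T : {set S}) a : (forall s, s \in T -> rdiv s a) ->
  exists v, reduced v /\ forall s, s \in T -> run ones v s < 0.
Proof.
move=> H; have [|v [z [_ rv Hv]]] := @reduced_left_multiple (enum T) (rev a).
  move=> s; rewrite mem_enum => /H [a' /ae_rev]; rewrite rev_rcons => aE.
  by exists (rev a').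
exists (rev v); split; first exact: reduced_rev.
move=> s sT; have [|X /ae_rev] := Hv s; first by rewrite mem_enum.
rewrite rev_cons => vX; rewrite (ae_run _ vX) run_descent.
by have /asc_rcons [] := ae_asc vX (reduced_rev rv).
Qed.

Lemma run_opp l w u : run (fun x => - l x) w u = - run l w u.
Proof.
elim: w l => //= s w IH l; rewrite -IH; congr (run _ _ _).
by apply: functional_extensionality => x; rewrite /fire; case: eqP; lra.
Qed.

Section Finite.
Variables (T : {set S}) (v : seq S).
Hypothesis rv : reduced v.
Hypothesis vT : forall s, s \in T -> run ones v s < 0.
(** Positive on [T], so the game over [T] can start here; its ascending words descend along [v]. *)
Let l0 u := - run ones v u.

Lemma l0_pos s : s \in T -> 0 < l0 s.
Proof. by move/vT; rewrite /l0; lra. Qed.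

(* Each step of an ascending [T]-word from [-(state of v)] strips a letter of [v]. *)
Lemma asc_bounded w : word_over T w -> asc l0 w ->
  exists v', [/\ reduced v', run ones v' = run (run ones v) w & (size v' + size w = size v)%N].
Proof.
elim/last_ind: w => [|w s IH]; first by exists v; rewrite addn0.
rewrite over_rcons asc_rcons => /andP[sT wT] [aw ws].
have [v' [rv' v'E sz]] := IH wT aw.
have hs : run ones v' s < 0 by rewrite v'E; move: ws; rewrite run_opp; lra.
have [v2 [_ rv2 v2E]] := exchange ones_gt0 (in_setT s) (overT v') rv' hs.
exists v2; split=> //.
  by rewrite run_rcons -v'E (ae_run _ v2E) run_rcons fireK.
by move: sz; rewrite (ae_size v2E) !size_rcons addnS.
Qed.

Lemma cox_catr (w : seq S) a b : word_over T w -> cox_eq E m T a b -> cox_eq E m T (a ++ w) (b ++ w).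
Proof.
move=> wT; elim=> [x y H|x|x y _|x y z _ + _].
- apply: rst_step; case: H => [u u' s uT u'T sT|u u' s t uT u'T sT tT Est]; rewrite -!catA.
    by apply: CoxSq => //; rewrite over_cat u'T.
  by apply: CoxBraid => //; rewrite over_cat u'T.
- exact: rst_refl.
- exact: rst_sym.
- exact: rst_trans.
Qed.

Lemma ae_cox a b : word_over T a -> a ~~> b -> cox_eq E m T a b.
Proof.
move=> aT ab; elim: ab aT => [x y [u u' s t Est]|x _|x y xy IH yT|x y z xy IH1 yz IH2 xT].
- rewrite !over_cat /word_over all_alt ?m_ge2 // => /and3P[uT /andP[sT tT] u'T].
  by apply: rst_step; exact: CoxBraid.
- exact: rst_refl.
- by apply: rst_sym; apply: IH; rewrite (ae_over _ xy).
- by apply: rst_trans (IH1 xT) (IH2 _); rewrite -(ae_over _ xy).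
Qed.

(** When the new letter does not ascend, exchange makes the word before it end in the same letter,
    and the square cancels in the Coxeter group. *)
Lemma cox_asc w : word_over T w -> exists w', [/\ word_over T w', asc l0 w' & cox_eq E m T w w'].
Proof.
elim/last_ind: w => [|w s IH]; first by exists [::]; split=> //; exact: rst_refl.
rewrite over_rcons => /andP[sT /IH [w' [w'T aw' ww']]].
have s1 : word_over T [:: s] by rewrite /= sT.
have ws : cox_eq E m T (rcons w s) (rcons w' s) by rewrite -!cats1; exact: cox_catr.
case: (Rlt_le_dec 0 (run l0 w' s)) => hs.
  by exists (rcons w' s); split; [rewrite over_rcons sT|apply/asc_rcons|].
have n0 := run_neq0 l0_pos sT w'T aw'.
have [|w2 [w2T aw2 w2E]] := exchange l0_pos sT w'T aw'; first by lra.
exists w2; split=> //; apply: (rst_trans _ _ _ _ _ ws).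
apply: (@rst_trans _ _ _ (rcons (rcons w2 s) s)).
  by rewrite -!(cats1 _ s); apply: cox_catr => //; rewrite cats1; exact: ae_cox.
apply: rst_step; rewrite -!cats1 -catA /= -{2}(cats0 w2) -(cats0 [:: s; s]).
exact: CoxSq.
Qed.

(** Ascending representatives are no longer than [v], by [asc_bounded]; the list consists of all
    words up to that length. *)
Lemma finite_of_descents : coxeter_finite E m T.
Proof.
pose words k := [seq val t | t : k.-tuple S].
exists (flatten [seq words k | k <- iota 0 (size v).+1]) => w wT.
have [w' [w'T aw' ww']] := cox_asc wT; exists w' => //.
have [v' [_ _ sz]] := asc_bounded w'T aw'.
apply/flatten_mapP; exists (size w'); first by rewrite mem_iota /= add0n ltnS -sz leq_addl.
by apply/mapP; exists (in_tuple w'); rewrite ?mem_enum.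
Qed.
End Finite.

Lemma finite_of_rdiv (T : {set S}) a :
  (forall s, s \in T -> rdiv s a) -> coxeter_finite E m T.
Proof. by move=> /reduced_right_multiple [v [rv vT]]; exact: finite_of_descents rv vT. Qed.

(** * Monoid cosets *)

Definition tred (T : {set S}) a := forall s, s \in T -> ~ rdiv s a.

Lemma tred_factor T a : exists b t, [/\ a ~~> b ++ t, word_over T t & tred T b].
Proof.
elim/ltn_ind: {a}(size a) {-2}a (erefl (size a)) => n IH a an.
case: (classic (exists2 s, s \in T & rdiv s a)) => [[s sT [a' aE]]|H]; last first.
  exists a, [::]; rewrite cats0; split=> //; first exact: ae_refl.
  by move=> s sT rs; apply: H; exists s.
have sz := ae_size aE; rewrite size_rcons in sz.
have [|b [t [a'b tT tb]]] := IH (size a') _ a' erefl; first by rewrite -an sz.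
exists b, (rcons t s); split=> //; last by rewrite over_rcons sT.
by apply: (ae_trans aE); rewrite -!cats1 catA; exact: ae_catr.
Qed.

(** If the last letters differ, [reduction_right] gives a common left factor [V] up to words in two
    letters of [T]; its T-reduced part is compared with [b] and [c] by induction. *)
Lemma tred_uniq T b x c y : tred T b -> tred T c -> word_over T x -> word_over T y ->
  b ++ x ~~> c ++ y -> b ~~> c.
Proof.
move: {2}(size (b ++ x)) (erefl (size (b ++ x))) => n.
elim/ltn_ind: n b x c y => n IH b x c y xn tb tc.
have over_nil a z w : word_over T w -> tred T a -> a ~~> z ++ w -> w = [::].
  case: (lastP w) => // {}w t; rewrite over_rcons => /andP[tT _] ta aE.
  by case: (ta t tT); exists (z ++ w); rewrite rcons_cat.
case: (lastP x) xn => [|{}x s] xn.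
  by move=> _ yT; rewrite cats0 => bE; move: (bE); rewrite (over_nil _ _ _ yT tb bE) cats0.
case: (lastP y) => [xT _|{}y t].
  rewrite cats0 => /ae_sym cE.
  by have := over_nil _ _ _ xT tc cE; case: (x).
rewrite !over_rcons -!rcons_cat => /andP[sT xT] /andP[tT yT] H.
have xs : (size (b ++ x) < n)%N by rewrite -xn -rcons_cat size_rcons.
have ys : (size (c ++ y) < n)%N.
  by rewrite -xn -rcons_cat (ae_size H) size_rcons.
case: (reduction_right H) => [[_ bc]|[V [d [d' [bV cV dst d'st]]]]].
  exact: (IH _ xs _ x _ y).
have sub : [set s; t] \subset T by exact: set2_sub.
have [v [z [Vv zT tv]]] := tred_factor T V.
have over w : word_over [set s; t] w -> word_over T (z ++ w).
  by move=> wst; rewrite over_cat zT; exact: word_over_sub wst.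
have toV w w' : w ~~> V ++ w' -> w ~~> v ++ (z ++ w').
  by move=> wV; apply: (ae_trans wV); rewrite catA; exact: ae_catr.
apply: (@ae_trans v).
  exact: (IH _ xs b x v (z ++ d) erefl tb tv xT (over _ dst) (toV _ _ bV)).
apply: ae_sym.
exact: (IH _ ys c y v (z ++ d') erefl tc tv yT (over _ d'st) (toV _ _ cV)).
Qed.

(** Uniqueness of the T-reduced part lets two comparisons through a middle word be composed, so the
    transitive closure collapses. *)
Lemma approxP T a b : approx_T E m T a b <->
  exists c x y, [/\ tred T c, word_over T x /\ word_over T y, a ~~> c ++ x & b ~~> c ++ y].
Proof.
split=> [|[c [x [y [tc [xT yT] ax bx]]]]]; last first.
  apply: (@t_trans _ _ _ c); apply: t_step.
    by exists [::], x; rewrite cats0.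
  by exists y, [::]; rewrite cats0; split=> //; split=> //; exact: ae_sym.
elim=> [{}a {}b [t [t' [tT [t'T ab]]]]|{}a d {}b _].
  have [c [x [ax xT tc]]] := tred_factor T a.
  have [c' [y [by' yT tc']]] := tred_factor T b.
  exists c, x, y; split=> //; apply: (ae_trans by'); apply: ae_catr.
  apply: ae_sym; apply: (@tred_uniq T c (x ++ t) c' (y ++ t')) => //.
  - by rewrite over_cat xT.
  - by rewrite over_cat yT.
  rewrite !catA; apply: (ae_trans (ae_catr _ (ae_sym ax))); apply: (ae_trans ab).
  exact: ae_catr.
move=> [c [x [y [tc [xT yT] ax dx]]]] _ [c' [x' [y' [tc' [xT' yT'] dx' bx']]]].
exists c, x, y'; split=> //; apply: (ae_trans bx'); apply: ae_catr.
apply: (@tred_uniq T c' x' c y) => //; exact: ae_trans (ae_sym dx') dx.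
Qed.

Lemma approx_refl T a : approx_T E m T a a.
Proof. by apply: t_step; exists [::], [::]; do 2![split=> //]; exact: ae_refl. Qed.

Lemma approx_sym T a b : approx_T E m T a b -> approx_T E m T b a.
Proof. by rewrite !approxP => -[c [x [y [tc [xT yT] ax by']]]]; exists c, y, x. Qed.

Lemma approx_trans T a b c : approx_T E m T a b -> approx_T E m T b c -> approx_T E m T a c.
Proof. exact: t_trans. Qed.

Lemma approx_ae T a b : a ~~> b -> approx_T E m T a b.
Proof. by move=> ab; apply: t_step; exists [::], [::]; rewrite !cats0. Qed.

Lemma approx_over T a t : word_over T t -> approx_T E m T a (a ++ t).
Proof.
move=> tT; apply: t_step; exists t, [::]; rewrite cats0.
by do 2![split=> //]; exact: ae_refl.
Qed.

Lemma approx_sub (T U : {set S}) a b : T \subset U ->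
  approx_T E m T a b -> approx_T E m U a b.
Proof.
move=> TU; elim=> [x y [t [t' [tT [t'T H]]]]|x y z _ + _]; last exact: approx_trans.
by apply: t_step; exists t, t'; rewrite !(word_over_sub TU).
Qed.

Lemma approx_set0 a b : approx_T E m set0 a b -> a ~~> b.
Proof.
have nil w : word_over set0 w -> w = [::] by case: w => //= s w; rewrite inE.
move/approxP => [c [x [y [_ [/nil-> /nil->]]]]]; rewrite !cats0 => ac bc.
exact: ae_trans ac (ae_sym bc).
Qed.

(** If [a] followed by a letter of [T] stays in the coset over [U], left cancellation puts the
    letter in [U]. Hence a vertex determines its set. *)
Lemma approx_incl (T U : {set S}) a b :
  (forall x, approx_T E m T a x -> approx_T E m U b x) -> T \subset U.
Proof.
move=> H; apply/subsetP => t tT.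
have ba := H _ (approx_refl T a).
have /H bat : approx_T E m T a (a ++ [:: t]) by apply: approx_over; rewrite /= tT.
have /approxP [c [x [y [tc [xU yU] ax aty]]]] := approx_trans (approx_sym ba) bat.
have : x ++ [:: t] ~~> y.
  apply: (@cancel_left c); rewrite catA; apply: ae_trans aty; apply: ae_catr.
  exact: ae_sym.
by move/(@ae_over U); rewrite yU over_cat xU /= andbT => ->.
Qed.

Lemma tred_approx_size T a b : tred T a -> approx_T E m T a b -> (size a <= size b)%N.
Proof.
move=> ta /approxP [c [x [y [tc [xT yT] ax by']]]].
rewrite (ae_size by') size_cat (@ae_size a c) ?leq_addr //.
by apply: (@tred_uniq T a [::] c x) => //; rewrite cats0.
Qed.

Lemma tred_approx_eq T a b : tred T a -> tred T b -> approx_T E m T a b -> a ~~> b.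
Proof.
move=> ta tb /approxP [c [x [y [tc [xT yT] ax by']]]].
apply: (@ae_trans c); last apply: ae_sym.
  by apply: (@tred_uniq T a [::] c x) => //; rewrite cats0.
by apply: (@tred_uniq T b [::] c y) => //; rewrite cats0.
Qed.

(** A T-reduced word is shortest in its coset, so an equally long [b] has no right divisor in [T]
    either. *)
Lemma approx_size_eq T a b : tred T a -> approx_T E m T a b -> size a = size b -> a ~~> b.
Proof.
move=> ta ab sz; apply: (tred_approx_eq ta) (ab) => s sT [b' bE].
have : approx_T E m T a b'.
  apply: (approx_trans ab); apply: approx_trans (approx_ae _ bE) _.
  by rewrite -cats1; apply/approx_sym/approx_over; rewrite /= sT.
by move/(tred_approx_size ta); rewrite sz (ae_size bE) size_rcons ltnn.
Qed.

Lemma finite_set0 : coxeter_finite E m set0.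
Proof.
exists [:: [::]] => -[|s w]; last by rewrite /= inE.
by exists [::] => //; exact: rst_refl.
Qed.

(** * Vertices, their generating sets and levels *)

Local Notation vtype := (vertex E m).

(* The class [[a]_T], with junk value [[a]_set0] when [W_T] is infinite. *)
Definition coset (T : {set S}) (a : seq S) : vtype.
Proof.
exists (approx_T E m (if excluded_middle_informative (coxeter_finite E m T) then T else set0) a).
exists a, (if excluded_middle_informative (coxeter_finite E m T) then T else set0).
by case: excluded_middle_informative => hT; split=> //; exact: finite_set0.
Defined.

Lemma cosetE T a : coxeter_finite E m T ->
  forall w, proj1_sig (coset T a) w <-> approx_T E m T a w.
Proof. by rewrite /coset /=; case: excluded_middle_informative. Qed.

Lemma vertex_repr (v : vtype) : exists p : seq S * {set S},
  [/\ coxeter_finite E m p.2, tred p.2 p.1 & v = coset p.2 p.1].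
Proof.
case: v => P hP; case: (hP) => a [T [fT PE]].
have [b [t [ab tT tb]]] := tred_factor T a.
exists (b, T); split=> //; apply: vertex_ext => x; rewrite cosetE //= PE.
have ba : approx_T E m T b a.
  exact: approx_trans (approx_over _ tT) (approx_ae _ (ae_sym ab)).
by split; apply: approx_trans => //; exact: approx_sym.
Qed.

Definition vrepr v := proj1_sig (constructive_indefinite_description _ (vertex_repr v)).
Definition vword v := (vrepr v).1.
Definition vgens v := (vrepr v).2.
Definition level v := size (vword v).

Lemma vreprP v : [/\ coxeter_finite E m (vgens v), tred (vgens v) (vword v) &
  v = coset (vgens v) (vword v)].
Proof. by rewrite /vgens /vword /vrepr; case: constructive_indefinite_description. Qed.

Lemma vred v : tred (vgens v) (vword v). Proof. by case: (vreprP v). Qed.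

Lemma vmem v x : proj1_sig v x <-> approx_T E m (vgens v) (vword v) x.
Proof. by case: (vreprP v) => hf _ {1}->; exact: cosetE. Qed.

Lemma mem_vword v : proj1_sig v (vword v).
Proof. by apply/vmem; exact: approx_refl. Qed.

Lemma vle_gens v w : vle v w -> vgens v \subset vgens w.
Proof.
move=> vw; apply: (@approx_incl _ _ (vword v) (vword w)) => x /vmem /vw /vmem //.
Qed.

Lemma vle_of v w a : vgens v \subset vgens w -> proj1_sig v a -> proj1_sig w a -> vle v w.
Proof.
move=> /approx_sub sub /vmem va /vmem wa x /vmem vx; apply/vmem.
by apply: (approx_trans wa); apply: sub; apply: approx_trans vx; exact: approx_sym.
Qed.

Lemma coset_gens T a : coxeter_finite E m T -> vgens (coset T a) = T.
Proof.
move=> fT; apply/eqP; rewrite eqEsubset; apply/andP; split;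
  [apply: (@approx_incl _ _ (vword (coset T a)) a)|apply: (@approx_incl _ _ a (vword (coset T a)))];
  move=> x; by rewrite -vmem cosetE.
Qed.

Lemma coset_mem T a : coxeter_finite E m T -> proj1_sig (coset T a) a.
Proof. by move=> fT; rewrite cosetE //; exact: approx_refl. Qed.

Lemma coset_le T a w : coxeter_finite E m T ->
  vle (coset T a) w <-> T \subset vgens w /\ proj1_sig w a.
Proof.
move=> fT; split=> [h|[Tw wa]].
  by split; [rewrite -(coset_gens a fT); exact: vle_gens|apply: h; exact: coset_mem].
by apply: (@vle_of _ _ a) => //; [rewrite coset_gens|exact: coset_mem].
Qed.

Lemma level_le_size v a : proj1_sig v a -> (level v <= size a)%N.
Proof. by move=> /vmem; apply: tred_approx_size; exact: vred. Qed.

Lemma vword_eq v a : proj1_sig v a -> level v = size a -> vword v ~~> a.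
Proof. by move=> /vmem va lv; apply: (approx_size_eq (vred (v := v))). Qed.

Lemma level_lt v a s : proj1_sig v a -> s \in vgens v -> rdiv s a -> (level v < size a)%N.
Proof.
move=> va sv [a' aE]; rewrite (ae_size aE) size_rcons ltnS; apply: level_le_size.
apply/vmem; move/vmem: va => va; apply: (approx_trans va).
apply: approx_trans (approx_ae _ aE) _; rewrite -cats1.
by apply/approx_sym/approx_over; rewrite /= sv.
Qed.

(** A word longer than the level of its coset is not T-reduced. With [level_lt], this describes the
    vertices of lower level above a base by sets meeting the right descents. *)
Lemma rdiv_of_level_lt v a : proj1_sig v a -> (level v < size a)%N ->
  exists2 s, s \in vgens v & rdiv s a.
Proof.
move=> va la; apply: NNPP => H.
suff ta : tred (vgens v) a.
  move: la; rewrite ltnNge; case/negP.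
  by apply: (tred_approx_size ta); apply/approx_sym; exact/vmem.
by move=> s sv rs; apply: H; exists s.
Qed.

(** * The retraction of a vertex link *)

Definition rdescents (a : seq S) : {set S} :=
  [set s | if excluded_middle_informative (rdiv s a) then true else false].

Lemma rdescentsP s a : s \in rdescents a <-> rdiv s a.
Proof. by rewrite inE; case: excluded_middle_informative. Qed.

Definition base v := coset set0 (vword v).
Definition top v := coset (rdescents (vword v)) (vword v).
Definition trim v w := coset (vgens w :&: rdescents (vword v)) (vword v).

(** Ensures that [top] and [trim] are the intended classes and not the default value of [coset]. *)
Lemma rdescents_finite (T : {set S}) a : T \subset rdescents a -> coxeter_finite E m T.
Proof.
by move=> /subsetP Ta; apply: (@finite_of_rdiv T a) => s /Ta /rdescentsP.
Qed.

Lemma top_fin v : coxeter_finite E m (rdescents (vword v)).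
Proof. exact: rdescents_finite (subxx _). Qed.

Lemma trim_fin v w : coxeter_finite E m (vgens w :&: rdescents (vword v)).
Proof. exact: rdescents_finite (subsetIr _ _). Qed.

Lemma coset0_ae a b : a ~~> b -> coset set0 a = coset set0 b.
Proof.
move=> ab; apply: vertex_ext => x; rewrite !cosetE; try exact: finite_set0.
by split; apply: approx_trans; apply: approx_ae => //; exact: ae_sym.
Qed.

Lemma base_le v w : vle (base v) w <-> proj1_sig w (vword v).
Proof.
rewrite coset_le; last exact: finite_set0.
by split=> [[]|] //; split=> //; exact: sub0set.
Qed.

Lemma vword_coset0 a : vword (coset set0 a) ~~> a.
Proof.
have := mem_vword (coset set0 a); rewrite cosetE; last exact: finite_set0.
by move/approx_set0 => ?; exact: ae_sym.
Qed.

Lemma base_base v : base (base v) = base v.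
Proof. by apply: coset0_ae; exact: vword_coset0. Qed.

Lemma level_base v : level (base v) = level v.
Proof. by apply: ae_size; exact: vword_coset0. Qed.

Lemma base_le_self v : vle (base v) v.
Proof. by apply/base_le; exact: mem_vword. Qed.

Lemma level_antitone v w : vle v w -> (level w <= level v)%N.
Proof. by move=> vw; apply: level_le_size; apply: vw; exact: mem_vword. Qed.

Lemma base_eq v w : vle v w -> level v = level w -> base v = base w.
Proof.
move=> vw e; apply: coset0_ae; apply: ae_sym; apply: vword_eq; last by rewrite -e.
by apply: vw; exact: mem_vword.
Qed.

Lemma base_level0 v : level v = 0%N -> base v = coset set0 [::].
Proof. by rewrite /level /base => /size0nil ->. Qed.

Lemma trim_le v w : vle (base v) w -> vle (trim v w) w.
Proof. by move/base_le => wv; rewrite coset_le ?subsetIl //; exact: trim_fin. Qed.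

Lemma base_le_trim v w : vle (base v) (trim v w).
Proof. by apply/base_le/coset_mem/trim_fin. Qed.

Lemma trim_le_top v w : vle (trim v w) (top v).
Proof.
rewrite coset_le; last exact: trim_fin.
by rewrite coset_gens ?subsetIr; [split=> //; apply/coset_mem/top_fin|exact: top_fin].
Qed.

Lemma base_le_top v : vle (base v) (top v).
Proof. by apply/base_le/coset_mem/top_fin. Qed.

Lemma trim_mono v u w : vle u w -> vle (trim v u) (trim v w).
Proof.
move=> /vle_gens uw; rewrite coset_le; last exact: trim_fin.
rewrite coset_gens; last exact: trim_fin.
by split; [exact: setSI|apply/coset_mem/trim_fin].
Qed.

(** The divisor that witnesses the lower level of [w] lies in both intersected sets, so trimming
    keeps it. *)
Lemma level_trim v w : vle (base v) w -> (level w < level v)%N ->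
  (level (trim v w) < level v)%N.
Proof.
move=> /base_le wv /(rdiv_of_level_lt wv) [s sw rs].
apply: (@level_lt _ _ s) => //; first exact/coset_mem/trim_fin.
rewrite coset_gens; last exact: trim_fin.
by rewrite inE sw; exact/rdescentsP.
Qed.

Lemma level_top v : (0 < level v)%N -> (level (top v) < level v)%N.
Proof.
move=> lv; have [s rs] : exists s, rdiv s (vword v).
  move: lv; rewrite /level; case/lastP: (vword v) => // a s _.
  by exists s, a; exact: ae_refl.
apply: (@level_lt _ _ s) => //; first exact/coset_mem/top_fin.
rewrite coset_gens; last exact: top_fin.
exact/rdescentsP.
Qed.

Lemma artin_contractible : contractible_realization E m.
Proof.
apply: (@contractible_of_retraction S E m level base top trim (coset set0 [::])).
- exact: base_base.
- exact: level_base.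
- exact: base_le_self.
- exact: level_antitone.
- exact: base_eq.
- exact: base_level0.
- exact: trim_le.
- exact: base_le_trim.
- exact: trim_le_top.
- exact: base_le_top.
- exact: trim_mono.
- exact: level_trim.
- exact: level_top.
Qed.

End Words.

Theorem theorem4p1 (S : finType) (E : rel S) (m : S -> S -> nat) :
  (forall s t, E s t = E t s) ->
  (forall s, ~~ E s s) ->
  (forall s t, m s t = m t s) ->
  (forall s t, E s t -> 2 <= m s t) ->
  contractible_realization E m.
Proof. exact: artin_contractible. Qed.
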